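(* Let $\Omega\subset\mathbb{R}^n$ be a bounded domain with Lipschitz boundary, $F\in (L^2(\Omega))^n$, $H\in L^2(\Omega)$, and let $\varphi:\Omega\times\mathbb{R}^n\to\mathbb{R}$ be convex, continuous and homogeneous of degree 1 with respect to its second argument, and such that (i) there is $\alpha>0$ with $0\le \varphi(x,\xi)\le \alpha|\xi|$ for all $\xi\in\mathbb{R}^n$, and (ii) $\xi\mapsto\varphi(x,\xi)$ is a norm on $\mathbb{R}^n$ for every $x$. Consider the primal problem $$(P)\qquad \inf_{u\in \mathring{H}^1(\Omega)} \int_\Omega \big(\varphi(x,Du+F)+Hu\big)\,dx$$ and its dual problem $$(D)\qquad \sup\Big\{\int_\Omega F\cdot b\,dx \;:\; b\in\mathcal{D}_0,\ \varphi^0(x,b(x))\le 1 \text{ in } \Omega\Big\}.$$ Then the duality gap is zero and the dual problem $(D)$ has a solution, i.e. there exists a vector field $N\in\mathcal{D}_0$ with $\varphi^0(x,N)\le 1$ such that $$\inf_{u\in \mathring{H}^1(\Omega)} \int_\Omega \big(\varphi(x,Du+F)+Hu\big)\,dx=\int_\Omega F\cdot N\,dx .$$ Moreover, $$\varphi\Big(x,\frac{Du+F}{|Du+F|}\Big)=N\cdot\frac{Du+F}{|Du+F|}\qquad |Du+F|\text{-a.e. in }\Omega,$$ for any minimizer $u$ of $(P)$.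
   Context: $\mathring{H}^1(\Omega)=\{u\in H^1(\Omega):\int_\Omega u\,dx=0\}$; for $u\in H^1(\Omega)$, $Du=\nabla u$ is the weak gradient. $\mathcal{D}_0=\{b\in (L^2(\Omega))^n : \int_\Omega (\nabla u\cdot b+Hu)\,dx=0 \text{ for all } u\in\mathring{H}^1(\Omega)\}$. $\varphi^0$ is the dual norm: $\varphi^0(x,\xi)=\sup\{\xi\cdot p : p\in\mathbb{R}^n,\ \varphi(x,p)\le 1\}$.
   Formalization: Existence of N is asserted only when inf (P) is not -∞, since otherwise no N in D_0 with φ^0(x,N) ≤ 1 exists (e.g. Ω=(0,1), φ=|ξ|, F=0, H=100cos(2πx)); φ is also assumed measurable in x so that the integral makes sense. *)

(* Defs.v *)
From HB Require Import structures.
From mathcomp Require Import all_boot all_order all_algebra.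
From mathcomp Require Import all_classical all_reals all_analysis.

Set Implicit Arguments.
Unset Strict Implicit.
Unset Printing Implicit Defensive.

Import Order.TTheory GRing.Theory Num.Theory.
Import numFieldNormedType.Exports.

Local Open Scope classical_set_scope.
Local Open Scope ring_scope.

(* R^n is 'rV[R]_n.  Its topology is the library one; its sigma-algebra is the
   one generated by the coordinates, i.e. the Borel sigma-algebra.  Elements of
   L^2 are represented by Borel functions, and two weak gradients of the same
   function agree almost everywhere, so no statement below depends on the
   choice of representatives. *)

Definition measure_row_display : measure_display -> measure_display.
Proof. exact. Qed.

Section measurable_row.
Context {d} {T : measurableType d} (n : nat).

Definition row_coord (i : 'I_n) (v : 'rV[T]_n) : T := v ord0 i.

Let row_set0 : g_sigma_preimage row_coord set0.
Proof. exact: sigma_algebra0. Qed.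

Let row_setC A : g_sigma_preimage row_coord A ->
  g_sigma_preimage row_coord (~` A).
Proof. exact: sigma_algebraC. Qed.

Let row_bigcup (F : (set 'rV[T]_n)^nat) :
  (forall i, g_sigma_preimage row_coord (F i)) ->
  g_sigma_preimage row_coord (\bigcup_i (F i)).
Proof. exact: sigma_algebra_bigcup. Qed.

HB.instance Definition _ := @isMeasurable.Build (measure_row_display d)
  'rV[T]_n (g_sigma_preimage row_coord) row_set0 row_setC row_bigcup.

End measurable_row.

Section measurable_row_theory.
Context d1 d2 (T1 : measurableType d1) (T2 : measurableType d2) (n : nat).

Lemma measurable_row_coord (i : 'I_n) :
  measurable_fun [set: 'rV[T2]_n] (fun v : 'rV[T2]_n => v ord0 i).
Proof.
move=> _ Y mY; rewrite setTI; apply: sub_sigma_algebra => /=.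
rewrite -bigcup_seq/=; exists i => /=; first by rewrite mem_index_enum.
by exists Y => //; rewrite setTI.
Qed.

Lemma measurable_fun_row (f : T1 -> 'rV[T2]_n) :
  (forall i, measurable_fun [set: T1] (fun x => f x ord0 i)) ->
  measurable_fun [set: T1] f.
Proof.
move=> mf _ Y mY; rewrite setTI.
suff : @measurable _ 'rV[T2]_n `<=` [set B | measurable (f @^-1` B)].
  by apply.
apply: smallest_sub.
  split => /=; first by rewrite preimage_set0.
  - by move=> A mA; rewrite setTD preimage_setC; exact: measurableC.
  - by move=> F mF; rewrite preimage_bigcup; exact: bigcupT_measurable.
move=> A; rewrite -bigcup_seq => -[i _ [B mB <-]] /=.
by rewrite setTI; have := mf i measurableT B mB; rewrite setTI.
Qed.

End measurable_row_theory.

Section lebesgue_row.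
Context {R : realType}.

Definition row_cons n (p : R * 'rV[R]_n) : 'rV[R]_n.+1 :=
  \row_(i < n.+1) if unlift ord0 i is Some j then p.2 ord0 j else p.1.

Lemma measurable_row_cons n : measurable_fun setT (@row_cons n).
Proof.
apply: measurable_fun_row => i.
under eq_fun do rewrite mxE.
case: unliftP => [j _|_]; last exact: measurable_fst.
by apply: (measurableT_comp (measurable_row_coord j)).
Qed.

Definition row_uncons n (v : 'rV[R]_n.+1) : R * 'rV[R]_n :=
  (v ord0 ord0, \row_(j < n) v ord0 (lift ord0 j)).

Lemma measurable_row_uncons n : measurable_fun setT (@row_uncons n).
Proof.
apply: measurable_fun_pair; first exact: measurable_row_coord.
apply: measurable_fun_row => i.
by under eq_fun do rewrite mxE; exact: measurable_row_coord.
Qed.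

Lemma row_consK n : cancel (@row_cons n) (@row_uncons n).
Proof.
move=> [x v]; rewrite /row_uncons mxE unlift_none; congr pair.
by apply/rowP => j; rewrite !mxE liftK.
Qed.

Section row_product.
Context (nu : {sigma_finite_measure set (measurableTypeR R) -> \bar R}).
Context (n : nat) (mu : {sigma_finite_measure set 'rV[R]_n -> \bar R}).

Definition row_product : set 'rV[R]_n.+1 -> \bar R :=
  pushforward (nu \x mu)%E (@row_cons n).

Let row_product_set0 : row_product set0 = 0%E.
Proof. by rewrite /row_product /pushforward preimage_set0 measure0. Qed.

Let row_product_ge0 A : (0 <= row_product A)%E.
Proof. exact: (measure_ge0 (nu \x mu)%E). Qed.

Let row_product_sigma_additive : semi_sigma_additive row_product.
Proof.
move=> F mF tF mUF; rewrite /row_product /pushforward preimage_bigcup.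
have mpre A : measurable A -> measurable (@row_cons n @^-1` A).
  by move=> mA; rewrite -[X in measurable X]setTI; exact: measurable_row_cons.
apply: measure_semi_sigma_additive.
- by move=> k; exact: mpre.
- apply/trivIsetP => /= i j _ _ ij; rewrite -preimage_setI.
  by move/trivIsetP : tF => /(_ _ _ _ _ ij) ->//; rewrite preimage_set0.
- by rewrite -preimage_bigcup; exact: mpre.
Qed.

HB.instance Definition _ := isMeasure.Build _ _ _ row_product
  row_product_set0 row_product_ge0 row_product_sigma_additive.

Let sigma_finite_step : sigma_finite setT row_product.
Proof.
have /sigma_finiteP[F [TF ndF Foo]] := sigma_finiteT nu.
have /sigma_finiteP[G [TG ndG Goo]] := sigma_finiteT mu.
exists (fun i => @row_uncons n @^-1` (F i `*` G i)).
  rewrite -preimage_bigcup (_ : \bigcup_i _ = setT) ?preimage_setT//.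
  rewrite -setXTT TF TG; apply/seteqP; split => [[x y] [k _ []]|[x y]].
    by move=> /= Fx Gy; split; exists k.
  move=> [/= [k _ Fkx] [l _ Gly]]; exists (maxn k l) => //; split.
  - by move: x Fkx; exact/subsetPset/ndF/leq_maxl.
  - by move: y Gly; exact/subsetPset/ndG/leq_maxr.
move=> i; have [mFi Fi] := Foo i; have [mGi Gi] := Goo i.
have mFG : measurable (F i `*` G i) by exact: measurableX.
split; first by rewrite -[X in measurable X]setTI; exact: measurable_row_uncons.
rewrite /row_product /pushforward (_ : _ @^-1` _ = F i `*` G i).
  by rewrite product_measure1E// lte_mul_pinfty// ge0_fin_numE.
by apply/funext => x; rewrite /preimage/= -[in RHS](row_consK x).
Qed.

HB.instance Definition _ :=
  Measure_isSigmaFinite.Build _ _ _ row_product sigma_finite_step.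

End row_product.

Fixpoint lebesgue_row n : {sigma_finite_measure set 'rV[R]_n -> \bar R} :=
  if n is m.+1 then row_product lebesgue_measure (lebesgue_row m)
  else \d_(0 : 'rV[R]_0).

Lemma lebesgue_row_box n (A : 'I_n -> set R) :
  (forall i, measurable (A i : set (measurableTypeR R))) ->
  lebesgue_row n [set v | forall i, A i (v ord0 i)] =
  (\prod_(i < n) lebesgue_measure (A i))%E.
Proof.
elim: n A => [A _|n IHn A mA].
  by rewrite big_ord0 /= diracE mem_set// => -[].
have mB : measurable [set v : 'rV[R]_n | forall i, A (lift ord0 i) (v ord0 i)].
  rewrite (_ : [set v | _] = \bigcap_(i in [set: 'I_n])
    ((fun v : 'rV[R]_n => v ord0 i) @^-1` A (lift ord0 i))).
    apply: fin_bigcap_measurable => // i _; rewrite -[X in measurable X]setTI.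
    by apply: measurable_row_coord => //; exact: mA.
  by apply/seteqP; split => v H i; [move=> _; exact: H|exact: (H i I)].
rewrite big_ord_recl -IHn => [|i]; last exact: mA.
rewrite -product_measure1E//.
rewrite /= /row_product /pushforward; congr (_ \x _)%E.
apply/seteqP; split => [[x v] /= H|[x v] /= [Ax Av] i].
  by split=> [|i]; [have := H ord0|have := H (lift ord0 i)];
    rewrite mxE (unlift_none, liftK).
by rewrite mxE; case: unliftP => [j ->|->].
Qed.

End lebesgue_row.

Section euclidean.
Context {R : realType} {n : nat}.
Implicit Types x y : 'rV[R]_n.

Definition dot x y : R := \sum_(i < n) x ord0 i * y ord0 i.

(* the library norm on 'rV[R]_n is the sup norm *)
Definition enorm x : R := Num.sqrt (dot x x).

End euclidean.

Section domains.
Context {R : realType} {n : nat}.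
Implicit Types Om : set 'rV[R]_n.

Definition bounded_domain Om :=
  [/\ open Om, connected Om, Om !=set0 & bounded_set Om].

(* Near each boundary point, Om is the strict epigraph, in some unit direction
   e, of a Lipschitz function of the component orthogonal to e.  A Lipschitz
   function on the hyperplane orthogonal to e extends to the whole space by
   composition with the orthogonal projection, so gam is taken total. *)
Definition lipschitz_boundary Om :=
  forall z, (closure Om `\` Om°) z ->
  exists (r : R) (e : 'rV[R]_n) (gam : 'rV[R]_n -> R^o),
    [/\ 0 < r, enorm e = 1, lipschitz gam &
      forall y, enorm (y - z) < r ->
        (Om y <-> gam (y - dot y e *: e) < dot y e)].

End domains.

Section sobolev.
Context {R : realType} {n : nat}.
Implicit Types (Om : set 'rV[R]_n) (u f : 'rV[R]_n -> R)
  (v : 'rV[R]_n -> 'rV[R]_n).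

Definition partial (i : 'I_n) f : 'rV[R]_n -> R :=
  fun x => 'D_(delta_mx ord0 i) (f : 'rV[R]_n -> R^o) x.

Definition iter_partial (s : seq 'I_n) f : 'rV[R]_n -> R := foldr partial f s.

Definition smooth f := forall s : seq 'I_n,
  continuous (iter_partial s f) /\
  forall i x,
    derivable (iter_partial s f : 'rV[R]_n -> R^o) x (delta_mx ord0 i).

Definition test_function Om f :=
  [/\ smooth f, compact (closure [set x | f x != 0]) &
      closure [set x | f x != 0] `<=` Om].

Definition L2 Om u := (u \_ Om) \in Lfun (lebesgue_row n) 2%:E.

Definition L2_field Om v := forall i, L2 Om (fun x => v x ord0 i).

Definition weak_gradient Om u v := forall f, test_function Om f -> forall i,
  (\int[lebesgue_row n]_(x in Om) (u x * partial i f x)%:E =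
   - \int[lebesgue_row n]_(x in Om) (v x ord0 i * f x)%:E)%E.

(* u is in H^1(Om) and Du is its weak gradient *)
Definition H1 Om u Du := [/\ L2 Om u, L2_field Om Du & weak_gradient Om u Du].

Definition H1_mean0 Om u Du :=
  H1 Om u Du /\ (\int[lebesgue_row n]_(x in Om) (u x)%:E = 0)%E.

End sobolev.

Section norms.
Context {R : realType} {n : nat}.

Definition is_norm (N : 'rV[R]_n -> R) :=
  [/\ forall p q, N (p + q) <= N p + N q,
      forall (t : R) p, N (t *: p) = `|t| * N p &
      forall p, N p = 0 -> p = 0].

Definition dual_norm (phi : 'rV[R]_n -> 'rV[R]_n -> R) (x xi : 'rV[R]_n)
  : \bar R := ereal_sup [set (dot xi p)%:E | p in [set p | phi x p <= 1]].

End norms.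

Section duality.
Context {R : realType} {n : nat}.
Variables (Om : set 'rV[R]_n) (phi : 'rV[R]_n -> 'rV[R]_n -> R).
Variables (F : 'rV[R]_n -> 'rV[R]_n) (H : 'rV[R]_n -> R).
Local Open Scope ereal_scope.

Definition primal_energy (u : 'rV[R]_n -> R) (Du : 'rV[R]_n -> 'rV[R]_n) :=
  \int[lebesgue_row n]_(x in Om) (phi x (Du x + F x) + H x * u x)%:E.

Definition primal_inf : \bar R :=
  ereal_inf [set primal_energy w.1 w.2 | w in [set w | H1_mean0 Om w.1 w.2]].

Definition primal_minimizer u Du :=
  H1_mean0 Om u Du /\ primal_energy u Du = primal_inf.

Definition D0 (b : 'rV[R]_n -> 'rV[R]_n) :=
  L2_field Om b /\ forall u Du, H1_mean0 Om u Du ->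
    \int[lebesgue_row n]_(x in Om) (dot (Du x) (b x) + H x * u x)%:E = 0.

Definition dual_feasible (b : 'rV[R]_n -> 'rV[R]_n) :=
  D0 b /\ {ae lebesgue_row n, forall x, Om x -> dual_norm phi x (b x) <= 1}.

Definition dual_energy (b : 'rV[R]_n -> 'rV[R]_n) :=
  \int[lebesgue_row n]_(x in Om) (dot (F x) (b x))%:E.

Definition dual_sup : \bar R :=
  ereal_sup [set dual_energy b | b in dual_feasible].

End duality.

(* the measure |v| dx on Om *)
Definition variation_measure {R : realType} {n : nat} (Om : set 'rV[R]_n)
    (v : 'rV[R]_n -> 'rV[R]_n) : set 'rV[R]_n -> \bar R :=
  fun A => (\int[lebesgue_row n]_(x in A `&` Om) (enorm (v x))%:E)%E.

(* Main.v *)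
(* Let m be the infimum and p(w) the integral of phi(x, w) over Om, a sublinear
   functional on (L^1)^n.  The pairs (Du, \int H u), u in H^1 with mean zero,
   form a linear space K on which p(F + d) + c >= m.  Hahn-Banach gives a linear
   l <= p with l(d) + c = 0 on K and l(F) >= m.  Since l <= p is bounded by alpha
   times the L^1 norm, l is integration against a bounded field N; the identity
   on K says that N is in D_0, and l <= p localizes to N . xi <= phi(x, xi) a.e.
   The optimality condition is the equality case of phi(x, v) >= N . v,
   integrated. *)
Require Import Defs.
From HB Require Import structures.
From mathcomp Require Import all_boot all_order all_algebra.
From mathcomp Require Import all_classical all_reals all_analysis.
From mathcomp Require Import measurable_realfun ring lra.

Set Implicit Arguments.
Unset Strict Implicit.
Unset Printing Implicit Defensive.

Import Order.TTheory GRing.Theory Num.Theory.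
Import numFieldNormedType.Exports.

Local Open Scope classical_set_scope.
Local Open Scope ring_scope.

(** * A sandwich form of the Hahn-Banach theorem *)

Section hahn_banach.
Context {R : realType} {E : lmodType R}.
Implicit Types (p g : E -> R) (C : set (E * R)).

(** [K] consists of pairs because [\int H u] depends on [u], whereas [p] only sees [Du]. Carried as
    a second coordinate, it becomes the constant term of an affine constraint on [l], and the
    requirements [l d + c = 0] and [l F >= m] fit into a single convex cone. Hahn-Banach can stay
    purely algebraic: continuity of [l] comes from [l <= p], and the linear growth of [phi] makes it
    continuity for the L^1 norm. This is why the fields are taken in L^1: the representing field is
    then bounded, hence in L^2 since the domain is bounded. The dual problem is attained because the
    functional produced by Hahn-Banach is already the optimal field. Linear functionals below [p]
    are obtained as minimal sublinear functionals, not by extending partially defined linear maps.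
    Localizing [l <= p] gives, for each fixed vector [xi], an inequality outside a null set that
    depends on [xi]. Hence rational vectors are treated first, and the others by density. *)

Definition sublinear p :=
  (forall x y, p (x + y) <= p x + p y) /\
  (forall (t : R) x, 0 <= t -> p (t *: x) <= t * p x).

(** A pair [(x, c)] encodes the constraint [0 <= l x + c] on an unknown linear functional [l]. *)
Definition convex_cone C := [/\ C (0, 0),
  (forall a b, C a -> C b -> C (a.1 + b.1, a.2 + b.2)) &
  (forall (t : R) a, 0 <= t -> C a -> C (t *: a.1, t * a.2))].

Lemma sublinear0 p : sublinear p -> p 0 = 0.
Proof.
move=> [pD pZ]; apply/eqP; rewrite eq_le; apply/andP; split.
  by have := pZ 0 0 (lexx _); rewrite scale0r mul0r.
by have := pD 0 0; rewrite addr0 lerDl.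
Qed.

Lemma sublinear_geN p x : sublinear p -> - p (- x) <= p x.
Proof.
by move=> pS; rewrite -subr_ge0 opprK -(sublinear0 pS) -(subrr x); exact: pS.1.
Qed.

(* The infimal convolution of p with the cone C decreases p just enough to make
   every linear functional below it nonnegative on C. *)
Lemma sublinear_infconv p C : sublinear p -> convex_cone C ->
  (forall a, C a -> 0 <= p a.1 + a.2) ->
  exists h, [/\ sublinear h, forall x, h x <= p x &
    forall a, C a -> h (- a.1) <= a.2].
Proof.
move=> pS [C0 CD CZ] pC.
pose S x := [set p (x + a.1) + a.2 | a in C].
(* From [0 <= p a.1 + a.2] and [p a.1 <= p (x + a.1) + p (- x)]; this keeps the infimum finite. *)
have Slb x : lbound (S x) (- p (- x)).
  move=> _ [a Ca <-]; rewrite lerNl -subr_ge0 opprK addrC.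
  apply: le_trans (pC a Ca) _; rewrite addrAC lerD2r.
  by rewrite -{1}[a.1](addrK x) [a.1 + x]addrC pS.1.
have hS x : has_inf (S x).
  by split; [exists (p (x + 0) + 0), (0, 0)|exists (- p (- x))].
have hle x a : C a -> inf (S x) <= p (x + a.1) + a.2.
  by move=> Ca; apply: ge_inf; [exact: (hS x).2|exists a].
exists (fun x => inf (S x)); split.
- split=> [x y|t x t0].
    rewrite -lerBlDr; apply: lb_le_inf; first exact: (hS x).1.
    move=> _ [a Ca <-]; rewrite lerBlDl -lerBlDr.
    apply: lb_le_inf; first exact: (hS y).1.
    move=> _ [b Cb <-]; rewrite lerBlDr.
    apply: (le_trans (hle _ _ (CD _ _ Cb Ca))) => /=.
    rewrite [b.1 + a.1]addrC [x + y + _]addrACA.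
    by have := pS.1 (x + a.1) (y + b.1); lra.
  have [->|tn0] := eqVneq t 0.
    rewrite scale0r mul0r (le_trans (hle _ _ C0))//=.
    by rewrite !addr0 (sublinear0 pS).
  have tp : 0 < t by rewrite lt_neqAle eq_sym tn0.
  rewrite mulrC -ler_pdivrMr//; apply: lb_le_inf; first exact: (hS x).1.
  move=> _ [a Ca <-]; rewrite ler_pdivrMr// mulrC.
  apply: (le_trans (hle _ _ (CZ _ _ t0 Ca))) => /=.
  by rewrite -scalerDr mulrDr lerD2r; exact: pS.2.
- by move=> x; apply: (le_trans (hle _ _ C0)); rewrite /= !addr0.
- move=> a Ca; apply: (le_trans (hle _ _ Ca)).
  by rewrite addNr (sublinear0 pS) add0r.
Qed.

(** A pointwise infimum of sublinear functions need not be subadditive. On a chain it is: given a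
    member for [x] and another for [y], the smaller of the two serves at both points. *)
Lemma sublinear_chain_inf p (A : set (E -> R)) : sublinear p ->
  (forall g, A g -> sublinear g /\ forall x, g x <= p x) ->
  total_on A (fun f g => forall x, g x <= f x) ->
  exists2 h, sublinear h & forall g, A g -> forall x, h x <= g x <= p x.
Proof.
move=> pS AS Atot.
have [->|/set0P[g0 Ag0]] := eqVneq A set0; first by exists p.
pose S x := [set g x | g in A].
have hS x : has_inf (S x).
  split; first by exists (g0 x), g0.
  exists (- p (- x)) => _ [g Ag <-]; have [gS gp] := AS g Ag.
  by apply: le_trans (sublinear_geN _ gS); rewrite lerN2.
have hle x g : A g -> inf (S x) <= g x.
  by move=> Ag; apply: ge_inf; [exact: (hS x).2|exists g].
exists (fun x => inf (S x)); last first.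
  by move=> g Ag x; rewrite hle//=; exact: (AS g Ag).2.
split=> [x y|t x t0].
  rewrite -lerBlDr; apply: lb_le_inf; first exact: (hS x).1.
  move=> _ [f Af <-]; rewrite lerBlDl -lerBlDr.
  apply: lb_le_inf; first exact: (hS y).1.
  move=> _ [g Ag <-]; rewrite lerBlDr.
  have [fg|gf] := Atot f g Af Ag.
    apply: (le_trans (hle _ _ Ag)); apply: (le_trans ((AS g Ag).1.1 _ _)).
    by rewrite addrC lerD2l fg.
  apply: (le_trans (hle _ _ Af)); apply: (le_trans ((AS f Af).1.1 _ _)).
  by rewrite addrC lerD2r gf.
have [->|tn0] := eqVneq t 0.
  rewrite scale0r mul0r (le_trans (hle _ _ Ag0))//.
  by rewrite (sublinear0 (AS _ Ag0).1).
have tp : 0 < t by rewrite lt_neqAle eq_sym tn0.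
rewrite mulrC -ler_pdivrMr//; apply: lb_le_inf; first exact: (hS x).1.
move=> _ [g Ag <-]; rewrite ler_pdivrMr// mulrC.
by apply: (le_trans (hle _ _ Ag)); exact: (AS g Ag).1.2.
Qed.

Lemma minimal_sublinear p : sublinear p ->
  exists g, [/\ sublinear g, forall x, g x <= p x &
    forall h, sublinear h -> (forall x, h x <= g x) -> h = g].
Proof.
move=> pS; pose T := {g : E -> R | sublinear g /\ forall x, g x <= p x}.
(* Zorn produces maximal elements, so the pointwise order is reversed. *)
pose r (s t : T) := `[< forall x, sval t x <= sval s x >].
have [| | | |[g [gS gp]] gmin] := @Zorn T r.
- by move=> t; apply/asboolP.
- move=> a b c /asboolP ab /asboolP bc; apply/asboolP => x.
  exact: le_trans (bc x) (ab x).
- move=> [a Pa] [b Pb] /asboolP/= ab /asboolP/= ba; apply: eq_exist => /=.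
  by apply/funext => x; apply/eqP; rewrite eq_le ab ba.
- move=> A Atot.
  have [||h hS hA] := @sublinear_chain_inf p (sval @` A) pS.
  + by move=> _ [[g Pg] _ <-].
  + move=> _ _ [f Af <-] [g Ag <-].
    by have [/asboolP|/asboolP] := Atot _ _ Af Ag; [left|right].
  (* For the empty chain [hA] does not place [h] below [p], so [p] itself is the bound. *)
  have [A0|/set0P[[g0 [g0S g0p]] Ag0]] := eqVneq A set0.
    by exists (exist _ p (conj pS (fun x => lexx (p x)))); rewrite A0.
  have hp x : h x <= p x.
    have /andP[hg _] := hA g0 (ex_intro2 _ _ _ Ag0 erefl) x.
    exact: le_trans hg (g0p x).
  exists (exist _ h (conj hS hp)) => g Ag; apply/asboolP => x /=.
  by have /andP[] := hA (sval g) (ex_intro2 _ _ _ Ag erefl) x.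
exists g; split=> // h hS hg.
have hp x : h x <= p x by exact: le_trans (hg x) (gp x).
have := gmin (exist _ h (conj hS hp)).
by move=> /(_ (asboolT hg)) /(congr1 sval).
Qed.

(** Infimal convolution with the ray through [(y, - g y)] yields a sublinear [h <= g] with
    [h (- y) <= - g y]. Minimality forces [h = g], so [g] is odd, and an odd sublinear function is
    linear. *)
Lemma minimal_sublinear_linear g : sublinear g ->
  (forall h, sublinear h -> (forall x, h x <= g x) -> h = g) -> scalar g.
Proof.
move=> gS gmin.
have gN y : g (- y) = - g y.
  pose C := [set a : E * R | exists2 t : R, 0 <= t & a = (t *: y, - (t * g y))].
  have [| |h [hS hg hC]] := @sublinear_infconv g C gS.
  - split.
    + by exists 0 => //; rewrite scale0r mul0r oppr0.
    + move=> _ _ [s s0 ->] [t t0 ->]; exists (s + t); first exact: addr_ge0.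
      by rewrite /= scalerDl mulrDl opprD.
    + move=> t _ t0 [s s0 ->]; exists (t * s); first exact: mulr_ge0.
      by rewrite /= scalerA mulrN mulrA.
  - move=> _ [t t0 ->] /=; rewrite subr_ge0.
    have := gS.2 t^-1 (t *: y); rewrite invr_ge0 => /(_ t0).
    have [-> _|tn0] := eqVneq t 0; first by rewrite scale0r mul0r (sublinear0 gS).
    rewrite scalerA mulVf// scale1r mulrC ler_pdivlMr 1?mulrC//.
    by rewrite lt_neqAle eq_sym tn0.
  have hgE := gmin h hS hg; rewrite hgE in hC.
  apply/eqP; rewrite eq_le; apply/andP; split; last first.
    by have := sublinear_geN (- y) gS; rewrite opprK.
  have /hC/= : C (y, - g y) by exists 1 => //; rewrite scale1r mul1r.
  by [].
have gD x y : g (x + y) = g x + g y.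
  apply/eqP; rewrite eq_le gS.1/=.
  by have := gS.1 (- x) (- y); rewrite -opprD !gN; lra.
move=> t x y; rewrite gD; congr (_ + _).
have gZ (s : R) z : 0 <= s -> g (s *: z) = s * g z.
  move=> s0; apply/eqP; rewrite eq_le gS.2//=.
  by have := gS.2 s (- z) s0; rewrite scalerN !gN; lra.
have [t0|/ltW t0] := leP 0 t; first exact: gZ.
by have := gZ (- t) x; rewrite oppr_ge0 scaleNr gN => /(_ t0); lra.
Qed.

(** Once the cone is absorbed into [h], any linear [l] below [h] satisfies
    [- l a.1 = l (- a.1) <= h (- a.1) <= a.2]. *)
Lemma hahn_banach_cone p C : sublinear p -> convex_cone C ->
  (forall a, C a -> 0 <= p a.1 + a.2) ->
  exists l, [/\ scalar l, forall x, l x <= p x & forall a, C a -> 0 <= l a.1 + a.2].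
Proof.
move=> pS CC pC; have [h [hS hp hC]] := sublinear_infconv pS CC pC.
have [l [lS lh /(minimal_sublinear_linear lS) ll]] := minimal_sublinear hS.
exists l; split=> // [x|a Ca]; first exact: le_trans (lh x) (hp x).
have /le_trans/(_ (hC _ Ca)) := lh (- a.1).
have := ll (-1) a.1 0; rewrite addr0 scaleN1r (sublinear0 lS) addr0 => ->.
by rewrite mulN1r lerNl -subr_ge0 opprK.
Qed.

(* The separating cone is generated by (F, - m) and K. *)
Lemma sublinear_duality p (K : set (E * R)) (F : E) (m : R) : sublinear p ->
  convex_cone K -> (forall a, K a -> K (- a.1, - a.2)) ->
  (forall a, K a -> m <= p (F + a.1) + a.2) ->
  exists l, [/\ scalar l, forall x, l x <= p x,
    forall a, K a -> l a.1 + a.2 = 0 & m <= l F].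
Proof.
move=> pS KC KN mK.
have [K0 KD KZ] := KC.
pose C := [set a : E * R | exists2 t : R, 0 <= t &
  exists2 b, K b & a = (t *: F + b.1, b.2 - t * m)].
have [| |l [ll lp lC]] := @hahn_banach_cone p C pS.
- split.
  + by exists 0 => //; exists (0, 0) => //=; rewrite scale0r mul0r !addr0 subrr.
  + move=> _ _ [s s0 [a Ka ->]] [t t0 [b Kb ->]]; exists (s + t).
      exact: addr_ge0.
    exists (a.1 + b.1, a.2 + b.2); first exact: KD.
    by rewrite /= scalerDl addrACA; congr pair; ring.
  + move=> t _ t0 [s s0 [a Ka ->]]; exists (t * s); first exact: mulr_ge0.
    exists (t *: a.1, t * a.2); first exact: KZ.
    by rewrite /= scalerDr scalerA; congr pair; ring.
- move=> _ [t t0 [a Ka ->]] /=.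
  (* Homogeneity reduces this to the hypothesis at [s^-1] times [a]. *)
  have pos s : 0 < s -> s * m <= p (s *: F + a.1) + a.2.
    move=> s0; have si0 : 0 <= s^-1 by rewrite invr_ge0 ltW.
    have /= := mK _ (KZ _ _ si0 Ka).
    rewrite -{1}[F](@scalerK _ _ s) ?gt_eqF// -scalerDr.
    have := pS.2 s^-1 (s *: F + a.1) si0 => h1 h2.
    by rewrite mulrC -ler_pdivlMr// mulrC mulrDr; lra.
  have [t1|] := ltP 0 t; first by have := pos _ t1; lra.
  move=> tle0; have -> : t = 0 by apply/eqP; rewrite eq_le tle0.
  rewrite scale0r add0r mul0r subr0; rewrite leNgt; apply/negP => neg.
  set c := p a.1 + a.2 in neg.
  (* scaling a up would drive p (F + s a) below m *)
  pose s := (`|p F - m| + 1) / - c.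
  have s0 : 0 < s by rewrite divr_gt0 ?oppr_gt0// ltr_wpDl.
  have /= := mK _ (KZ _ _ (ltW s0) Ka).
  have h1 := pS.1 F (s *: a.1); have h2 := pS.2 s a.1 (ltW s0).
  have h3 : s * p a.1 + s * a.2 = - (`|p F - m| + 1).
    by rewrite -mulrDr -/c /s -mulrA invrN mulNr mulVf ?lt_eqF// mulrN1.
  by have := ler_norm (p F - m); lra.
have lK a : K a -> 0 <= l a.1 + a.2.
  move=> Ka; apply: lC; exists 0 => //; exists a => //.
  by rewrite scale0r add0r mul0r subr0; case: a Ka.
have l0 : l 0 = 0.
  by have := ll 1 0 0; rewrite scale1r addr0 mul1r; lra.
have lN x : l (- x) = - l x.
  by have := ll (-1) x 0; rewrite addr0 scaleN1r l0 addr0 mulN1r.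
exists l; split=> //.
(* [K] is symmetric, so the inequality at [a] and at its opposite gives equality. *)
- move=> a Ka; apply/eqP; rewrite eq_le lK// andbT.
  by have := lK _ (KN _ Ka); rewrite /= lN; lra.
- have /= := lC (F, - m); rewrite subr_ge0; apply.
  by exists 1 => //; exists (0, 0) => //=; rewrite scale1r addr0 mul1r sub0r.
Qed.

End hahn_banach.

(** * Functionals dominated by an L^1 norm *)

Section bounded_functional.
Import HBSimple.
Context d (T : measurableType d) (R : realType).
Variable mu : {sigma_finite_measure set T -> \bar R}.
Local Notation L1 f := (mu.-integrable setT (EFin \o (f : T -> R))).

(** Tested on [A = D & {g < f}], the hypothesis makes the integral of the positive function [f - g]
    over [A] nonpositive, so [A] is null. *)
Lemma ae_le_of_integral (D : set T) (f g : T -> R) : measurable D ->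
  mu.-integrable D (EFin \o f) -> mu.-integrable D (EFin \o g) ->
  (forall A, measurable A -> A `<=` D ->
    \int[mu]_(x in A) f x <= \int[mu]_(x in A) g x) ->
  {ae mu, forall x, D x -> f x <= g x}.
Proof.
move=> mD intf intg fgA.
have mf : measurable_fun D f by exact/measurable_EFinP/(measurable_int _ intf).
have mg : measurable_fun D g by exact/measurable_EFinP/(measurable_int _ intg).
pose A := D `&` [set x | g x < f x].
have mA : measurable A.
  rewrite /A -[X in _ `&` X](_ : (fun x => g x < f x) @^-1` [set true] = _).
    exact: (measurable_fun_ltr mg mf).
  by apply/seteqP; split.
have AD : A `<=` D by exact: subIsetl.
have intAf := integrableS mD mA AD intf.
have intAg := integrableS mD mA AD intg.
have fg0 x : A x -> 0 <= f x - g x by move=> [_ /ltW]; rewrite subr_ge0.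
have int0 : (\int[mu]_(x in A) `|(f x - g x)%:E| = 0)%E.
  rewrite (eq_integral (fun x => (f x - g x)%:E)); last first.
    by move=> x /set_mem Ax; rewrite gee0_abs// lee_fin fg0.
  apply/eqP; rewrite eq_le; apply/andP; split; last first.
    by apply: integral_ge0 => x Ax; rewrite lee_fin fg0.
  rewrite -[leLHS]fineK; last exact: (integrable_fin_num mA (integrableB mA intAf intAg)).
  rewrite lee_fin; have := RintegralB mA intAf intAg.
  by rewrite {1}/Rintegral => ->; rewrite subr_le0; exact: fgA.
have mfg : measurable_fun A (fun x => (f x - g x)%:E).
  exact: measurable_int (integrableB mA intAf intAg).
have := (ae_eq_integral_abs mu mA mfg).1 int0; apply: filterS => x Ax0 Dx.
rewrite leNgt; apply/negP => gf; have := Ax0 (conj Dx gf).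
by move=> [] /eqP; rewrite subr_eq0 gt_eqF.
Qed.

Variables (D : set T) (l : (T -> R) -> R) (C : R).
Hypotheses (mD : measurable D) (muD : (mu D < +oo)%E) (C_ge0 : 0 <= C).
Hypothesis lD : forall (a : R) f g, L1 f -> L1 g ->
  l (fun x => a * f x + g x) = a * l f + l g.
Hypothesis lC : forall f, L1 f -> `|l f| <= C * \int[mu]_(x in D) `|f x|.

Let L1_lin (a : R) f g : L1 f -> L1 g -> L1 (fun x => a * f x + g x).
Proof. by move=> lf lg; apply: (integrableD _ (integrableZl _ a lf) lg). Qed.

Let L1_cst0 : L1 (cst 0). Proof. exact: integrable0. Qed.

Let l0 : l (cst 0) = 0.
Proof.
apply/eqP; rewrite -normr_le0 (le_trans (lC L1_cst0))//.
rewrite (@eq_Rintegral _ _ _ mu _ (cst 0)) ?Rintegral_cst ?mul0r ?mulr0//.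
by move=> x _; rewrite normr0.
Qed.

Let lZ (a : R) f : L1 f -> l (fun x => a * f x) = a * l f.
Proof.
move=> lf; have := lD a lf L1_cst0; rewrite l0 addr0 => <-.
by congr l; apply/funext => x; rewrite /= addr0.
Qed.

Let L1_sum I (s : seq I) (f : I -> T -> R) : (forall i, L1 (f i)) ->
  L1 (fun x => \sum_(i <- s) f i x) /\
  l (fun x => \sum_(i <- s) f i x) = \sum_(i <- s) l (f i).
Proof.
move=> lf; elim: s => [|i s [IH1 IH2]].
  rewrite big_nil; under eq_fun do rewrite big_nil.
  by split; [exact: L1_cst0|exact: l0].
rewrite big_cons -IH2 -[l (f i)]mul1r -lD//.
under eq_fun do rewrite big_cons -[f i _]mul1r.
by split=> //; exact: L1_lin.
Qed.

Let L1_indic A : measurable A -> L1 \1_(A `&` D).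
Proof.
move=> mA; apply/integrableP; split.
  by apply/measurable_EFinP/measurable_indic; exact: measurableI.
under eq_integral do rewrite /= ger0_norm//.
rewrite integral_indic//; last exact: measurableI.
rewrite setIT; apply: le_lt_trans muD; apply: le_measure; rewrite ?inE//.
exact: measurableI.
Qed.

Let l_indic A : measurable A -> `|l \1_(A `&` D)| <= C * fine (mu (A `&` D)).
Proof.
move=> mA; apply: (le_trans (lC (L1_indic mA))).
rewrite ler_wpM2l//; under eq_Rintegral do rewrite ger0_norm//.
by rewrite /Rintegral integral_indic//;
  [rewrite setIAC -setIA setIid|exact: measurableI].
Qed.

(** Intersecting with [D], of finite measure, keeps the indicator integrable, so the hypotheses on
    [l] apply to every measurable [A]. *)
Let nu (A : set T) : \bar R := (l \1_(A `&` D))%:E.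

Let nu0 : nu set0 = 0%E.
Proof. by rewrite /nu set0I indic0 l0. Qed.

Let nuU A B : measurable A -> measurable B -> A `&` B = set0 ->
  nu (A `|` B) = (nu A + nu B)%E.
Proof.
move=> mA mB AB; rewrite /nu -EFinD; congr EFin.
rewrite -[l \1_(A `&` D)]mul1r -lD ?L1_indic//; congr l.
apply/funext => x; rewrite mul1r !indicE.
have [Dx|Dx] := pselect (D x); last first.
  by rewrite !memNset ?addr0//; move=> [].
rewrite -natrD; congr (_%:R); rewrite !in_setI in_setU (mem_set Dx) !andbT.
have [Ax|] := boolP (x \in A); have [Bx|] //= := boolP (x \in B).
have : (A `&` B) x by split; exact: set_mem.
by rewrite AB.
Qed.

(** By finite additivity the error after [n] sets is [nu (V n)], where [V n] is the remaining tail.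
    It is at most [C * mu (V n & D)] in absolute value, and this tends to 0 by continuity from
    above, since [mu D] is finite. *)
Let nu_sigma_additive : semi_sigma_additive nu.
Proof.
move=> F mF tF mUF.
pose U n := \big[setU/set0]_(i < n) F i.
have mU n : measurable (U n) by exact: bigsetU_measurable.
pose V n := (\bigcup_k F k) `\` U n.
have mV n : measurable (V n) by exact: measurableD.
have nuS n : (\sum_(0 <= i < n) nu (F i))%R = nu (U n).
  rewrite big_mkord; elim: n => [|n IH];
    first by rewrite big_ord0 /U big_ord0 nu0.
  rewrite big_ord_recr /= IH (_ : U n.+1 = U n `|` F n); last first.
    by rewrite /U big_ord_recr.
  by rewrite nuU//; apply: (@trivIset_bigsetUI _ xpredT) => //;
    exact: sub_trivIset tF.
have UF n : U n `<=` \bigcup_k F k by exact: bigsetU_bigcup.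
have nuV n : nu (\bigcup_k F k) = (nu (U n) + nu (V n))%E.
  by rewrite -nuU// ?setDKU ?setDIK// setDUK.
have V0 : (fun n => mu (V n `&` D)) @ \oo --> 0%E.
  rewrite -(measure0 mu) (_ : set0 = \bigcap_n (V n `&` D)).
    apply: nonincreasing_cvg_mu => //.
    - by apply: le_lt_trans muD; apply: le_measure; rewrite ?inE//;
        exact: measurableI.
    - by move=> n; exact: measurableI.
    - by apply: bigcapT_measurable => n; exact: measurableI.
    - move=> m n mn; apply/subsetPset; apply: setSI; apply: setDS.
      exact: subset_bigsetU.
  apply/esym; rewrite -subset0 => x VDx.
  have [[[k _ Fkx] _] _] := VDx 0%N I; have [[_ nUx] _] := VDx k.+1 I.
  by apply: nUx; rewrite /U -bigcup_mkord; exists k => //=.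
rewrite (_ : (fun n => _) = nu \o U); last by apply/funext => n /=.
apply/fine_cvgP; split; first exact: nearW.
apply/cvgrPdist_le => e e0.
(* [C + 1] instead of [C], which may be 0. *)
have e1 : 0 < e / (C + 1) by rewrite divr_gt0// ltr_wpDl.
have /fine_cvgP[_ /cvgrPdist_le/(_ _ e1)] := V0.
apply: filterS => n; rewrite sub0r normrN => Vn.
have := nuV n; rewrite /nu -EFinD => -[].
rewrite addrC => /eqP; rewrite -subr_eq => /eqP ->.
apply: (le_trans (l_indic (mV n)));
  apply: (@le_trans _ _ ((C + 1) * (e / (C + 1)))).
  rewrite ler_pM ?fine_ge0//; first by rewrite lerDl.
  exact: le_trans (ler_norm _) Vn.
by rewrite mulrCA divff ?mulr1// gt_eqF// ltr_wpDl.
Qed.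

Let nu_finite A : measurable A -> nu A \is a fin_num.
Proof. by []. Qed.

HB.instance Definition _ :=
  isCharge.Build _ _ _ nu nu0 nu_finite nu_sigma_additive.

(* g is the Radon-Nikodym derivative of A |-> l 1_(A & D). *)
Lemma bounded_functional_integral : exists g : T -> R,
  [/\ measurable_fun setT g, forall x, `|g x| <= C &
    forall f, L1 f -> l f = \int[mu]_(x in D) (g x * f x)].
Proof.
have nu_mu : nu `<< mu.
  apply/null_content_dominatesP => A mA muA0.
  have := l_indic mA; rewrite (_ : mu (A `&` D) = 0%E).
    by rewrite mulr0 normr_le0 /nu => /eqP ->.
  apply/eqP; rewrite -measure_le0 -muA0; apply: le_measure; rewrite ?inE//.
  exact: measurableI.
pose g0 := fine \o Radon_Nikodym nu mu.
have Eg0 : EFin \o g0 = Radon_Nikodym nu mu.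
  by apply/funext => x /=; rewrite fineK// Radon_Nikodym_fin_num.
have L1g0 : L1 g0 by rewrite Eg0; exact: Radon_Nikodym_integrable.
have g0A A : measurable A -> l \1_(A `&` D) = \int[mu]_(x in A) g0 x.
  move=> mA; rewrite /Rintegral -[LHS]/(fine (nu A)).
  by rewrite (Radon_Nikodym_integral nu_mu mA) -Eg0.
have mg0 : measurable_fun setT g0 by exact/measurable_EFinP/(measurable_int _ L1g0).
(* The density obeys the bound only almost everywhere on [D]; truncation makes it hold everywhere
   and changes [g0] only on a null part of [D]. *)
pose g x := Num.min C (Num.max (- C) (g0 x)).
have mg : measurable_fun setT g.
  by apply: measurable_minr => //; exact: measurable_maxr.
have gC x : `|g x| <= C.
  rewrite ler_norml /g ge_min lexx/= andbT le_min le_max lexx/=.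
  by rewrite (le_trans _ C_ge0)// oppr_le0.
have intD (k : R) : mu.-integrable D (EFin \o cst k).
  apply: measurable_bounded_integrable => //.
  by exists `|k|; split => // x kx y _ /=; exact: ltW.
have int0D : mu.-integrable D (EFin \o g0) by exact: integrableS L1g0.
have cle A (k : R) : measurable A -> A `<=` D ->
    \int[mu]_(x in A) (cst k) x = k * fine (mu (A `&` D)).
  by move=> mA AD; rewrite Rintegral_cst// (setIidl AD).
(* For [A] inside [D] the integral of [g0] over [A] is [l \1_A], which lies between [- C * mu A] and
   [C * mu A]. *)
have ae_lt : {ae mu, forall x, D x -> g0 x <= C}.
  apply: (ae_le_of_integral (g := cst C)) => // A mA AD.
  by rewrite cle// -g0A// (le_trans (ler_norm _))//; exact: l_indic.
have ae_gt : {ae mu, forall x, D x -> - C <= g0 x}.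
  apply: (ae_le_of_integral (f := cst (- C))) => // A mA AD.
  rewrite cle// -g0A// mulNr lerNl (le_trans (ler_norm _))// normrN.
  exact: l_indic.
have gg0 : {ae mu, forall x, D x -> g0 x = g x}.
  apply: filterS2 ae_lt ae_gt => x gle gge Dx; rewrite /g.
  by rewrite (max_idPr _) ?gge//; apply/esym/min_idPr; exact: gle.
have gA A : measurable A -> l \1_(A `&` D) = \int[mu]_(x in D) (g x * \1_(A `&` D) x).
  move=> mA; have mAD : measurable (A `&` D) by exact: measurableI.
  rewrite -[in LHS](setIid D) setIA g0A// Rintegral_mkcondl.
  rewrite /Rintegral; congr fine; apply: ae_eq_integral => //.
  - apply/measurable_EFinP.
    have mDg0 : measurable_fun D g0 by exact: measurable_funTS.
    rewrite (_ : _ \_ _ = g0 \* \1_A); last exact: patch_indic.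
    exact: measurable_funM.
  - apply/measurable_EFinP; apply: measurable_funM; first exact: measurable_funTS.
    exact: measurable_indic.
  - apply: filterS gg0 => x gx Dx /=.
    by rewrite patchE indicE in_setI (mem_set Dx) andbT gx//; case: ifP;
      rewrite ?mulr1 ?mulr0.
have gint f : mu.-integrable D (EFin \o f) ->
    mu.-integrable D (EFin \o (fun x => g x * f x)).
  move=> intf; apply: (integrableMr mD _ _ intf); first exact: measurable_funTS.
  by exists C; split=> [|y Cy x _ /=]; [exact: num_real|exact: le_trans (ltW Cy)].
have gle f : mu.-integrable D (EFin \o f) ->
    `|\int[mu]_(x in D) (g x * f x)| <= C * \int[mu]_(x in D) `|f x|.
  move=> intf; apply: (le_trans (le_normr_Rintegral mD (gint _ intf))).
  rewrite -RintegralZl//; last exact: integrable_norm.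
  apply: le_Rintegral => //; first exact: integrable_norm (gint _ intf).
    exact: (integrableZl mD _ (integrable_norm intf)).
  by move=> x Dx; rewrite normrM ler_wpM2r.
exists g; split=> // f L1f.
have L1D h : L1 h -> mu.-integrable D (EFin \o h) by exact: integrableS.
(* The bound on [l] integrates over [D] only, so [l] ignores values off [D]. *)
have lres h : L1 h -> mu.-integrable setT (EFin \o (h \_ D)) /\ l (h \_ D) = l h.
  move=> L1h; have L1hD : L1 (h \_ D).
    by rewrite -restrict_EFin; apply: (integrable_mkcond _ mD).1; exact: L1D.
  split=> //; apply/eqP; rewrite -subr_eq0 -mulN1r addrC -lD// -normr_le0.
  apply: (le_trans (lC (L1_lin _ L1h L1hD))).
  rewrite (@eq_Rintegral _ _ _ mu _ (cst 0)) ?Rintegral_cst ?mul0r ?mulr0//.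
  by move=> x xD; rewrite patchE xD mulN1r addNr normr0.
have [h [inth _ hcvg]] := approximation_sfun_integrable mD (L1D _ L1f).
have hE n : [/\ L1 ((h n : T -> R) \_ D) &
    l ((h n : T -> R) \_ D) = \int[mu]_(x in D) (g x * h n x)].
  have L1hn : L1 ((h n : T -> R) \_ D).
    by rewrite -restrict_EFin; apply: (integrable_mkcond _ mD).1; exact: inth.
  split=> //.
  have mh y : measurable (h n @^-1` [set y]) by exact: measurable_sfunP.
  pose s := finmap.enum_fset (fset_set (range (h n))).
  pose e y x := y * \1_(h n @^-1` [set y] `&` D) x.
  have L1e y : L1 (e y) by apply: (integrableZl _ y (L1_indic (mh y))).
  have eh : (h n : T -> R) \_ D = fun x => \sum_(y <- s) e y x.
    apply/funext => x; rewrite patchE; case: ifPn => [xD|xD].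
      rewrite fimfunE fsbig_finite//=; apply: eq_bigr => y _.
      by rewrite /e !indicE in_setI xD andbT.
    by rewrite big1// => y _; rewrite /e indicE in_setI (negbTE xD) andbF mulr0.
  rewrite eh (L1_sum s L1e).2.
  transitivity (\sum_(y <- s) \int[mu]_(x in D) (g x * e y x)).
    apply: eq_bigr => y _; rewrite /e lZ ?L1_indic// gA// -RintegralZl//.
      by apply: eq_Rintegral => x _; rewrite mulrCA.
    by apply/gint/L1D/L1_indic.
  transitivity (\int[mu]_(x in D) (\sum_(y <- s) g x * e y x)).
    elim: s {eh} => [|y s IH].
      rewrite big_nil (@eq_Rintegral _ _ _ mu _ (cst 0)) ?Rintegral_cst ?mul0r//.
      by move=> x _; rewrite big_nil.
    rewrite big_cons IH -RintegralD//.
    - by apply: eq_Rintegral => x _; rewrite big_cons.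
    - exact/gint/L1D/L1e.
    - under eq_fun do rewrite -mulr_sumr.
      by apply/gint/L1D; exact: (L1_sum s L1e).1.
  apply: eq_Rintegral => x xD; rewrite -mulr_sumr; congr (_ * _).
  by have := congr1 (@^~ x) eh; rewrite patchE xD => ->.
(* both sides are C-Lipschitz for the L1 distance on D *)
apply/eqP; rewrite -subr_eq0 -normr_le0; apply/ler_addgt0Pr => e e0.
rewrite add0r.
(* The factor 2 shares [e] between the errors of the two sides. *)
have e1 : 0 < e / (2 * (C + 1)) by rewrite divr_gt0// mulr_gt0// ltr_wpDl.
have /fine_cvgP[_ /cvgrPdist_le/(_ _ e1)[N _ hN]] := hcvg.
have := hN N (leqnn _); rewrite sub0r normrN /= => {}hN.
have intB : mu.-integrable D (EFin \o (fun x => f x - h N x)).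
  by apply: (integrableB mD (L1D _ L1f) (inth N)).
have {}hN : \int[mu]_(x in D) `|f x - h N x| <= e / (2 * (C + 1)).
  exact: le_trans (ler_norm _) hN.
have [L1h lh] := hE N.
have lfh : `|l f - l ((h N : T -> R) \_ D)| <= C * \int[mu]_(x in D) `|f x - h N x|.
  rewrite -[l _ - _]addrC -mulN1r -lD//.
  apply: (le_trans (lC (L1_lin _ L1h L1f))); rewrite ler_wpM2l//.
  rewrite (@eq_Rintegral _ _ _ mu _ (fun x => `|f x - h N x|))// => x xD.
  by rewrite patchE xD mulN1r addrC.
have gfh := gle _ intB.
rewrite (@eq_Rintegral _ _ _ mu _ (fun x => g x * f x - g x * h N x)) in gfh;
  last first.
  by move=> x _; rewrite mulrBr.
rewrite RintegralB// -?lh in gfh; [|exact/gint/L1D|exact: gint (inth N)].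
have -> : l f - \int[mu]_(x in D) (g x * f x) =
  (l f - l ((h N : T -> R) \_ D)) -
  (\int[mu]_(x in D) (g x * f x) - l ((h N : T -> R) \_ D)) by ring.
apply: (le_trans (ler_normB _ _)); apply: (le_trans (lerD lfh gfh)).
have J0 : 0 <= \int[mu]_(x in D) `|f x - h N x| by exact: Rintegral_ge0.
apply: (@le_trans _ _ (2 * (C + 1) * (e / (2 * (C + 1))))); last first.
  by rewrite mulrCA divff ?mulr1// gt_eqF// mulr_gt0// ltr_wpDl.
by apply: (@le_trans _ _ (2 * (C + 1) * \int[mu]_(x in D) `|f x - h N x|));
  [lra|rewrite ler_wpM2l// mulr_ge0// addr_ge0].
Qed.

End bounded_functional.

(** * Measurability of row-valued functions *)

Section row_measurability.
Context {R : realType} {n : nat}.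
Implicit Types (v : 'rV[R]_n) (Om : set 'rV[R]_n).

Lemma row_rat_approx (v : 'rV[R]_n) (e : R) : 0 < e ->
  exists q : 'rV[rat]_n, forall i, `|v ord0 i - ratr (q ord0 i)| < e.
Proof.
move=> e0; pose P i : set rat := [set q | `|v ord0 i - ratr q| < e].
exists (\row_i xget 0 (P i)) => i; rewrite mxE; apply: (@xgetPex _ 0 (P i)).
have [|r] := @rat_in_itvoo _ (v ord0 i - e) (v ord0 i + e).
  by rewrite ltrD2l gtrN.
by rewrite in_itv/= => /andP[r1 r2]; exists r; rewrite /P/= ltr_distlC r1 r2.
Qed.

(** The topology is that of the sup norm, so an open set is the union of the rational boxes it
    contains; these are countably many, and each is an intersection of coordinate preimages. *)
Lemma row_open_measurable (A : set 'rV[R]_n) : open A -> measurable A.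
Proof.
move=> oA.
pose box (c : 'rV[rat]_n * nat) : set 'rV[R]_n :=
  [set v | forall i, `|v ord0 i - ratr (c.1 ord0 i)| < c.2.+1%:R^-1].
have mbox c : measurable (box c).
  rewrite (_ : box c = \bigcap_(i in [set: 'I_n])
      ((fun v : 'rV[R]_n => v ord0 i) @^-1`
       ball (ratr (c.1 ord0 i) : R) c.2.+1%:R^-1)); last first.
    by apply/seteqP; split => v /= H i;
      [move=> _; rewrite /ball/= distrC|have := H i I; rewrite /ball/= distrC].
  apply: fin_bigcap_measurable => // i _; rewrite -[X in measurable X]setTI.
  by apply: measurable_row_coord => //; exact: measurable_ball.
rewrite (_ : A = \bigcup_c (if `[< box c `<=` A >] then box c else set0)).
  apply: countable_bigcupT_measurable => [|c]; first exact: countableP.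
  by case: asboolP.
apply/seteqP; split=> [x Ax|x [c _]]; last by case: asboolP => // + cx; apply.
have /nbhs_ballP[e /= e0 xeA] : nbhs x A by exact: open_nbhs_nbhs.
(* A box of radius below [e / 2] that contains [x] stays within [e] of [x]. *)
pose k := Num.trunc (2 / e).
have ke : k.+1%:R^-1 < e / 2.
  by rewrite -[e / 2]invf_div ltf_pV2 ?posrE ?divr_gt0 ?truncnS_gt.
have [|q qP] := @row_rat_approx x k.+1%:R^-1; first by rewrite invr_gt0.
exists (q, k) => //.
have -> : `[< box (q, k) `<=` A >] = true; last exact: qP.
apply/asboolP => v bv; apply: xeA; split=> // i j.
rewrite !(ord1 i) /ball/= -(subrK (ratr (q ord0 j)) (x _ _)) -addrA.
apply: (le_lt_trans (ler_normD _ _)); rewrite [ltRHS]splitr ltrD//.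
  exact: lt_trans (qP j) ke.
by apply: lt_trans ke; have := bv j; rewrite distrC.
Qed.

Lemma row_continuous_measurable (f : 'rV[R]_n -> R) :
  continuous f -> measurable_fun setT f.
Proof.
move=> /continuousP cf; apply: (measurability _ (RGenOpens.measurableE R)).
move=> _ [_ [a [b ->] <-]]; rewrite setTI; apply: row_open_measurable.
exact/cf/interval_open.
Qed.

Lemma bounded_row_box Om : bounded_set Om -> exists M : R,
  Om `<=` [set v | forall i, `[- M, M]%classic (v ord0 i)].
Proof.
move=> [M [Mreal OmM]]; exists (M + 1) => v /OmM normvleM i /=.
rewrite in_itv/= -ler_norml.
apply: le_trans (normvleM (M + 1) _); last by rewrite ltrDl.
by rewrite [leRHS]/Num.norm /= mx_normrE; apply/bigmax_geP; right;
  exists (ord0, i).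
Qed.

Lemma lebesgue_row_bounded_lty Om : measurable Om -> bounded_set Om ->
  (lebesgue_row n Om < +oo)%E.
Proof.
move=> mOm /bounded_row_box[M OmM].
pose box : set 'rV[R]_n := [set v | forall i, `[- M, M]%classic (v ord0 i)].
pose lenM := lebesgue_measure `[- M, M]%classic.
have boxE : (lebesgue_row n box = \prod_(i < n) lenM)%E.
  by apply: (@lebesgue_row_box R n (fun=> `[- M, M]%classic)) => i;
    exact: measurable_itv.
have mbox : measurable box.
  rewrite (_ : box = \bigcap_(i in [set: 'I_n])
      ((fun v : 'rV[R]_n => v ord0 i) @^-1` `[- M, M]%classic)); last first.
    by apply/seteqP; split => v /= H i; [move=> _; exact: H|exact: (H i I)].
  apply: fin_bigcap_measurable => // i _; rewrite -[X in measurable X]setTI.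
  by apply: measurable_row_coord => //; exact: measurable_itv.
apply: (@le_lt_trans _ _ (lebesgue_row n box)).
  by apply: le_measure; rewrite ?inE.
rewrite boxE; have lenM_fin : lenM \is a fin_num.
  by rewrite /lenM lebesgue_measure_itv/=; case: ifP.
rewrite ltey_eq; apply/orP; left.
by apply: (big_ind (fun y => y \is a fin_num)) => // *; exact: fin_numM.
Qed.

Lemma row_continuous_bounded Om (f : 'rV[R]_n -> R) : bounded_set Om ->
  continuous f -> exists M : R, forall x, Om x -> `|f x| <= M.
Proof.
move=> /bounded_row_box[M OmM] cf.
have /(continuous_compact (continuous_subspaceT cf)) :=
  @rV_compact R n (fun=> `[- M, M]%classic) (fun=> @segment_compact _ _ _).
move=> /(@compact_bounded R R^o)[N [Nreal fN]]; exists (N + 1) => x /OmM xM.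
by apply: fN; [rewrite ltrDl|exists x].
Qed.

(** Rounding [w] down to the grid of step [1 / (k + 1)] leaves countably many values, and on each
    level set measurability in [x] at a fixed vector suffices. Continuity in the second argument
    lets [k] tend to infinity. *)
Lemma measurable_caratheodory_fun d (T : measurableType d) (D : set T)
    (phi : T -> 'rV[R]_n -> R) (w : T -> 'rV[R]_n) : measurable D ->
  (forall xi, measurable_fun D (phi ^~ xi)) ->
  (forall x, D x -> continuous (phi x)) ->
  (forall i, measurable_fun D (fun x => w x ord0 i)) ->
  measurable_fun D (fun x => phi x (w x)).
Proof.
move=> mD mphi cphi mw.
pose z k x : 'rV[int]_n := \row_i Num.floor (k.+1%:R * w x ord0 i).
pose q k (a : 'rV[int]_n) : 'rV[R]_n := \row_i ((a ord0 i)%:~R / k.+1%:R).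
apply: (@measurable_fun_cvg _ _ _ _ (fun k x => phi x (q k (z k x)))).
  move=> k _ Y mY.
  have mz a : measurable (D `&` [set x | z k x = a]).
    rewrite (_ : _ `&` _ = D `&` \bigcap_(i in [set: 'I_n]) (D `&`
      (fun x => k.+1%:R * w x ord0 i) @^-1`
        `[(a ord0 i)%:~R, (a ord0 i + 1)%:~R[%classic)); last first.
      apply/seteqP; split=> [x [Dx <-]|x [Dx xa]]; split=> //.
        move=> i _; split=> //=.
        by rewrite in_itv/= mxE floor_itv.
      apply/rowP => i; rewrite mxE; apply: floor_def.
      by have [_ /=] := xa i I; rewrite in_itv.
    apply: measurableI => //; apply: fin_bigcap_measurable => // i _.
    by apply: (measurable_funM (measurable_cst _) (mw i)) => //;
      exact: measurable_itv.
  rewrite (_ : D `&` _ = \bigcup_a ((D `&` [set x | z k x = a]) `&`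
      (D `&` (phi ^~ (q k a)) @^-1` Y))).
    apply: countable_bigcupT_measurable => [|a]; first exact: countableP.
    by apply: measurableI => //; exact: mphi.
  apply/seteqP; split=> [x [Dx Yx]|x [a _ [[Dx <-] [_ Yx]]]].
    by exists (z k x).
  by split.
move=> x Dx; apply: (continuous_cvg _ (cphi x Dx (w x))).
apply/cvg_ballP => e e0; near=> k; split=> // i j; rewrite ord1 !mxE /ball/=.
have kp : 0 < k.+1%:R :> R by [].
have /andP[f1 f2] := floor_itv (k.+1%:R * w x ord0 j).
rewrite -(ltr_pM2l kp) -{1}(gtr0_norm kp) -normrM mulrBr.
rewrite [X in `|_ - X|]mulrC divfK ?gt_eqF//.
rewrite ger0_norm ?subr_ge0//; rewrite intrD in f2.
apply: (@lt_le_trans _ _ 1); first by lra.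
rewrite mulrC -ler_pdivrMr// div1r; near: k.
by apply: filterS (near_infty_natSinv_lt (PosNum e0)) => m /ltW.
Unshelve. all: by end_near. Qed.

End row_measurability.

(** * Square-integrable functions and weak gradients *)

Section square_integrable.
Context {R : realType} {n : nat}.
Variable Om : set 'rV[R]_n.
Implicit Types u v : 'rV[R]_n -> R.
Hypotheses (oOm : open Om) (bOm : bounded_set Om).
Local Notation mu := (lebesgue_row n).
Local Notation int f := (mu.-integrable Om (EFin \o (f : 'rV[R]_n -> R))).

Let mOm : measurable Om. Proof. exact: row_open_measurable. Qed.

Let muOm : (mu Om < +oo)%E. Proof. exact: lebesgue_row_bounded_lty. Qed.

Lemma L2_measurable u : L2 Om u -> measurable_fun Om u.
Proof.
move=> /andP[/[!inE] mu_ _]; apply: (measurable_restrictT _ mOm).2; exact: mu_.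
Qed.

Lemma L2_integrableM u v : L2 Om u -> L2 Om v -> int (fun x => u x * v x).
Proof.
move=> L2u L2v; apply/(integrable_mkcond _ mOm).2; rewrite restrict_EFin.
rewrite (_ : _ \_ _ = (u \_ Om) \* (v \_ Om)).
  exact/Lfun1_integrable/Lfun2_mul_Lfun1.
by apply/funext => x /=; rewrite !patchE; case: ifP; rewrite ?mulr0.
Qed.

Lemma bounded_L2 u (M : R) : measurable_fun Om u ->
  (forall x, Om x -> `|u x| <= M) -> L2 Om u.
Proof.
move=> mu_ uM; apply/andP; split; rewrite inE/=.
  exact: (measurable_restrictT _ mOm).1.
rewrite /finite_norm unlock /Lnorm poweR_lty//.
have mp : measurable_fun Om (fun x => `|u x| `^ 2).
  apply: (@measurableT_comp _ _ _ _ _ _ (@powR R ^~ 2)) => //.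
  exact: measurableT_comp.
have bp : [bounded `|u x| `^ 2 | x in Om].
  exists (M `^ 2); split; first exact: num_real.
  move=> y My x /uM uxM /=; rewrite ger0_norm ?powR_ge0//.
  apply: le_trans (ltW My); rewrite ge0_ler_powR// nnegrE.
  exact: le_trans uxM.
have := measurable_bounded_integrable mOm muOm mp bp.
move=> /(integrable_mkcond _ mOm).1/integrableP[_]; apply: le_lt_trans.
rewrite le_eqVlt; apply/orP; left; apply/eqP; apply: eq_integral => x _ /=.
rewrite !patchE; case: ifP => _ /=; first by rewrite (ger0_norm (powR_ge0 _ _)).
by rewrite normr0 powR0// abse0.
Qed.

Lemma L2_integrable u : L2 Om u -> int u.
Proof.
move=> L2u; have L21 : L2 Om (cst 1).
  by apply: (@bounded_L2 _ 1) => // x _; rewrite normr1.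
by have := L2_integrableM L2u L21; under eq_fun do rewrite mulr1.
Qed.

Lemma L2_lin (a : R) u v : L2 Om u -> L2 Om v -> L2 Om (fun x => a * u x + v x).
Proof.
move=> L2u L2v; rewrite /L2 (_ : _ \_ _ = a *: (u \_ Om) + (v \_ Om)).
  by apply: (Lfun_submod_closed _ _).2 => //; rewrite lee1n.
apply/funext => x; rewrite -[RHS]/(a * (u \_ Om) x + (v \_ Om) x) !patchE.
by case: ifP => // _; rewrite mulr0 addr0.
Qed.

Lemma L2_cst0 : L2 Om (fun=> 0).
Proof. by apply: (@bounded_L2 _ 0) => // x _; rewrite normr0. Qed.

Let int_continuousM u g : L2 Om u -> continuous g -> int (fun x => u x * g x).
Proof.
move=> L2u cg; have [M gM] := row_continuous_bounded bOm cg.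
apply: (integrableMl mOm (L2_integrable L2u)).
  by apply: measurable_funTS; exact: row_continuous_measurable.
by exists M; split=> [|y My x /gM gx /=];
  [exact: num_real|exact: le_trans (ltW My)].
Qed.

Let integral_lin (a : R) u v : int u -> int v ->
  (\int[mu]_(x in Om) (a * u x + v x)%:E =
   a%:E * \int[mu]_(x in Om) (u x)%:E + \int[mu]_(x in Om) (v x)%:E)%E.
Proof.
move=> iu iv; rewrite -integralZl// -integralD//.
exact: (integrableZl mOm a iu).
Qed.

Lemma H1_mean0_lin (a : R) u Du v Dv : H1_mean0 Om u Du -> H1_mean0 Om v Dv ->
  H1_mean0 Om (fun x => a * u x + v x) (fun x => a *: Du x + Dv x).
Proof.
move=> [[L2u L2Du wu] u0] [[L2v L2Dv wv] v0]; split; last first.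
  by rewrite integral_lin ?L2_integrable// u0 v0 mule0 adde0.
split; first exact: L2_lin.
  by move=> i; under eq_fun do rewrite !mxE; exact: L2_lin.
move=> f tf i; have [sf _ _] := tf.
have cf : continuous f by exact: (sf [::]).1.
have cpf : continuous (partial i f) by exact: (sf [:: i]).1.
under eq_integral do rewrite mulrDl -mulrA.
under [in RHS]eq_integral do rewrite !mxE mulrDl -mulrA.
rewrite !integral_lin ?int_continuousM//; try exact: L2Dv; try exact: L2Du.
rewrite (wu f tf i) (wv f tf i).
(* Finiteness lets the opposite distribute over a sum of extended reals. *)
have fin w : L2_field Om w ->
    (\int[mu]_(x in Om) (w x ord0 i * f x)%:E)%E \is a fin_num.
  by move=> L2w; apply: (integrable_fin_num mOm); apply: int_continuousM.
move: (fin Du L2Du) (fin Dv L2Dv); set X := integral _ _ _;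
  set Y := integral _ _ _.
move: X Y => X Y finX finY.
by rewrite muleN fin_num_oppeD// fin_numM.
Qed.

Lemma H1_mean00 : H1_mean0 Om (fun=> 0) (fun=> 0).
Proof.
split; last by rewrite integral0.
split; first exact: L2_cst0.
  by move=> i; under eq_fun do rewrite mxE; exact: L2_cst0.
move=> f _ i; under eq_integral do rewrite mul0r.
under [in RHS]eq_integral do rewrite mxE mul0r.
by rewrite !integral0 oppe0.
Qed.

End square_integrable.

(** * Representation of bounded functionals on (L^1)^n *)

Section row_functional.
Context {R : realType} {n : nat}.
Variable Om : set 'rV[R]_n.
Hypotheses (oOm : open Om) (bOm : bounded_set Om).
Local Notation mu := (lebesgue_row n).
Local Notation int f := (mu.-integrable Om (EFin \o (f : 'rV[R]_n -> R))).

Let mOm : measurable Om. Proof. exact: row_open_measurable. Qed.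

Let muOm : (mu Om < +oo)%E. Proof. exact: lebesgue_row_bounded_lty. Qed.

(** Functions from ['I_n] into an [lmodType] again form an [lmodType], as the Hahn-Banach lemmas
    require. *)
Definition L1_row := 'I_n -> LfunType mu (lexx (1%E : \bar R)).

(** Extension by 0 outside [Om]; the default 0 of [insubd] is taken only for a component that is not
    integrable on [Om]. *)
Definition L1_row_of (w : 'rV[R]_n -> 'rV[R]_n) : L1_row :=
  fun i => insubd 0 ((fun x => w x ord0 i) \_ Om).

Lemma L1_row_ofE (w : 'rV[R]_n -> 'rV[R]_n) i : int (fun x => w x ord0 i) ->
  L1_row_of w i = (fun x => w x ord0 i) \_ Om :> (_ -> _).
Proof.
move=> iw; apply: insubdK; apply/Lfun1_integrable.
by rewrite -restrict_EFin; exact: (integrable_mkcond _ mOm).1.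
Qed.

Lemma L1_row_int (e : L1_row) i : int (e i).
Proof.
apply: integrableS measurableT mOm _ _ => //.
by apply/Lfun1_integrable; exact: LfunP.
Qed.

Variables (l : L1_row -> R) (C : R).
Hypothesis l_scalar : scalar l.
Hypothesis C_ge0 : 0 <= C.
Hypothesis lC : forall e, l e <= C * \sum_(i < n) \int[mu]_(x in Om) `|e i x|.

(** Composed with the inclusion [at_ i] of the i-th coordinate, [l] is a bounded functional on
    scalar functions; its density is the i-th component of [N]. Linearity reassembles the
    coordinates. *)
Lemma bounded_row_functional : exists N : 'rV[R]_n -> 'rV[R]_n,
  [/\ forall i, measurable_fun setT (fun x => N x ord0 i),
      forall x i, `|N x ord0 i| <= C &
      forall w : 'rV[R]_n -> 'rV[R]_n, (forall i, int (fun x => w x ord0 i)) ->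
        l (L1_row_of w) = \int[mu]_(x in Om) dot (w x) (N x)].
Proof.
have l0 : l 0 = 0 by have := l_scalar 1 0 0; rewrite scale1r addr0 mul1r; lra.
have lD e f : l (e + f) = l e + l f.
  by have := l_scalar 1 e f; rewrite scale1r mul1r.
have lN e : l (- e) = - l e.
  by have := l_scalar (-1) e 0; rewrite addr0 scaleN1r l0 addr0 mulN1r.
pose toL (f : 'rV[R]_n -> R) : LfunType mu (lexx (1%E : \bar R)) := insubd 0 (f \_ Om).
have toLE f : int f -> toL f = f \_ Om :> (_ -> _).
  move=> iw; apply: insubdK; apply/Lfun1_integrable.
  by rewrite -restrict_EFin; exact: (integrable_mkcond _ mOm).1.
pose at_ (i : 'I_n) (g : LfunType mu (lexx (1%E : \bar R))) : L1_row :=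
  fun j => if j == i then g else 0.
have at_lin i a f g : at_ i (a *: f + g) = a *: at_ i f + at_ i g.
  apply/funext => j; rewrite -[RHS]/(a *: at_ i f j + at_ i g j) /at_.
  by case: ifP => //; rewrite scaler0 addr0.
have intS (f : 'rV[R]_n -> R) : mu.-integrable setT (EFin \o f) -> int f.
  by apply: integrableS.
have at_norm i f : int f -> l (at_ i (toL f)) <= C * \int[mu]_(x in Om) `|f x|.
  move=> iff; apply: (le_trans (lC _)); rewrite ler_wpM2l// (bigD1 i)//=.
  rewrite big1 ?addr0 => [|j ji].
    rewrite le_eqVlt; apply/orP; left; apply/eqP; apply: eq_Rintegral => x xOm.
    by rewrite /at_ eqxx toLE// patchE xOm.
  rewrite (@eq_Rintegral _ _ _ mu _ (cst 0)) ?Rintegral_cst ?mul0r//.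
  by move=> x _; rewrite /at_ (negbTE ji) normr0.
have toL_lin a f g : int f -> int g ->
    toL (fun x => a * f x + g x) = a *: toL f + toL g.
  move=> iff ig; apply/LfuneqP => x.
  rewrite toLE; last by apply: (integrableD _ (integrableZl _ a iff) ig).
  rewrite -[RHS]/(a * toL f x + toL g x) !toLE// !patchE.
  by case: ifP => //; rewrite mulr0 addr0.
have rep i : exists g : 'rV[R]_n -> R, [/\ measurable_fun setT g,
    forall x, `|g x| <= C & forall f, mu.-integrable setT (EFin \o f) ->
    l (at_ i (toL f)) = \int[mu]_(x in Om) (g x * f x)].
  apply: bounded_functional_integral => //.
    move=> a f g iff ig; rewrite toL_lin; [|exact: intS|exact: intS].
    by rewrite at_lin l_scalar.
  move=> f iff; rewrite ler_norml lerNl at_norm ?intS// andbT.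
  (* The hypothesis on [l] is one-sided; the lower bound is the upper one at [- f]. *)
  have ifN : int (fun x => - 1 * f x) by exact: (integrableZl mOm (-1) (intS _ iff)).
  have := at_norm i _ ifN.
  under eq_Rintegral do rewrite mulN1r normrN.
  apply: le_trans; rewrite -lN.
  rewrite (_ : toL (fun x => - 1 * f x) = -1 *: toL f + 0); last first.
    apply/LfuneqP => x; rewrite (toLE _ ifN).
    rewrite -[RHS]/(-1 * toL f x + 0) toLE ?intS// !patchE addr0.
    by case: ifP => //; rewrite mulr0.
  rewrite at_lin (_ : at_ i 0 = 0) ?addr0 ?scaleN1r//.
  by apply/funext => j; rewrite /at_; case: ifP.
have [g gP] := choice rep.
exists (fun x => \row_i g i x); split.
- by move=> i; under eq_fun do rewrite mxE; have [] := gP i.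
- by move=> x i; rewrite mxE; have [_ ->] := gP i.
move=> w iw; pose wr i := (fun x => w x ord0 i) \_ Om.
have iwr i : mu.-integrable setT (EFin \o wr i).
  by rewrite /wr -restrict_EFin; exact: (integrable_mkcond _ mOm).1.
have -> : L1_row_of w = \sum_(i < n) at_ i (toL (wr i)).
  apply/funext => j; rewrite fct_sumE (bigD1 j)//= big1 ?addr0 => [|i ij].
    apply/LfuneqP => x; rewrite /at_ eqxx L1_row_ofE// toLE ?intS//.
    by rewrite /wr !patchE; case: ifP.
  by rewrite /at_ eq_sym (negbTE ij).
rewrite (big_morph l lD l0).
have igw i : int (fun x => w x ord0 i * g i x).
  have [mg gC _] := gP i; apply: (integrableMl mOm (iw i));
    first exact: measurable_funTS.
  by exists C; split=> [|y Cy x _ /=]; [exact: num_real|exact: le_trans (ltW Cy)].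
transitivity (\sum_(i < n) \int[mu]_(x in Om) (w x ord0 i * g i x)).
  apply: eq_bigr => i _; have [_ _ ->//] := gP i.
  by apply: eq_Rintegral => x xOm; rewrite /wr patchE xOm mulrC.
rewrite /Rintegral sum_fine; last by move=> i _;
  exact: (integrable_fin_num mOm (igw i)).
rewrite -integral_sum//; congr fine; apply: eq_integral => x _.
by rewrite sumEFin; congr EFin; apply: eq_bigr => i _; rewrite mxE.
Qed.

End row_functional.

(** * Duality *)

Lemma enorm_le_sum (R : realType) n (v : 'rV[R]_n) :
  enorm v <= \sum_(i < n) `|v ord0 i|.
Proof.
have S0 : 0 <= \sum_(i < n) `|v ord0 i| by exact: sumr_ge0.
rewrite /enorm -[leRHS](ger0_norm S0) -sqrtr_sqr ler_wsqrtr//.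
rewrite expr2 mulr_suml /dot; apply: ler_sum => i _.
rewrite -expr2 -(real_normK (num_real _)) expr2 ler_wpM2l//.
by rewrite (bigD1 i)//= lerDl sumr_ge0.
Qed.

Lemma measurable_enorm (R : realType) n (D : set 'rV[R]_n)
    (v : 'rV[R]_n -> 'rV[R]_n) :
  (forall i, measurable_fun D (fun x => v x ord0 i)) ->
  measurable_fun D (fun x => enorm (v x)).
Proof.
move=> mv; apply: (measurableT_comp (continuous_measurable_fun (@sqrt_continuous R))).
by apply: measurable_sum => i; exact: measurable_funM.
Qed.

Section convex_integrand.
Context {R : realType} {n : nat}.
Variables (Om : set 'rV[R]_n) (phi : 'rV[R]_n -> 'rV[R]_n -> R) (alpha : R).
Hypotheses (oOm : open Om) (bOm : bounded_set Om).
Hypothesis phi_measurable : forall xi, measurable_fun Om (phi ^~ xi).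
Hypothesis phi_continuous : forall x, Om x -> continuous (phi x).
Hypothesis alpha_gt0 : 0 < alpha.
Hypothesis phi_bounds : forall x, Om x ->
  forall xi, 0 <= phi x xi <= alpha * enorm xi.
Hypothesis phi_norm : forall x, Om x -> is_norm (phi x).
Local Notation mu := (lebesgue_row n).
Local Notation int f := (mu.-integrable Om (EFin \o (f : 'rV[R]_n -> R))).
Implicit Types (w b F Du : 'rV[R]_n -> 'rV[R]_n) (H u : 'rV[R]_n -> R).

Let mOm : measurable Om. Proof. exact: row_open_measurable. Qed.

Let phi_ge0 x v : Om x -> 0 <= phi x v.
Proof. by move=> /phi_bounds/(_ v)/andP[]. Qed.

Let phi_le x v : Om x -> phi x v <= alpha * \sum_(i < n) `|v ord0 i|.
Proof.
move=> /phi_bounds/(_ v)/andP[_ /le_trans]; apply.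
by rewrite ler_wpM2l ?enorm_le_sum// ltW.
Qed.

Let phi0 x : Om x -> phi x 0 = 0.
Proof.
move=> /phi_norm[_ phiZ _]; have := phiZ 0 0.
by rewrite scale0r normr0 mul0r.
Qed.

Let phiZ x t v : Om x -> 0 <= t -> phi x (t *: v) = t * phi x v.
Proof. by move=> /phi_norm[_ phiZ _] t0; rewrite phiZ ger0_norm. Qed.

Let int_sum w : (forall i, int (fun x => w x ord0 i)) ->
  int (fun x => \sum_(i < n) `|w x ord0 i|).
Proof.
move=> iw.
rewrite (_ : EFin \o _ = fun x => (\sum_(i < n) `|w x ord0 i|%:E)%E); last first.
  by apply/funext => x /=; rewrite sumEFin.
by apply: integrable_sum => // i _; exact: (integrable_norm (iw i)).
Qed.

Lemma integrand_integrable w : (forall i, int (fun x => w x ord0 i)) ->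
  int (fun x => phi x (w x)).
Proof.
move=> iw; apply: (le_integrable mOm _ _ (integrableZl mOm alpha (int_sum iw))).
  apply/measurable_EFinP; apply: measurable_caratheodory_fun => // i.
  by apply/measurable_EFinP; exact: measurable_int (iw i).
move=> x Om_x /=; rewrite lee_fin ger0_norm ?phi_ge0// ger0_norm ?phi_le//.
by rewrite mulr_ge0 ?sumr_ge0// ltW.
Qed.

Definition integrand_energy (e : @L1_row R n) : R :=
  \int[mu]_(x in Om) phi x (\row_i e i x).

Let int_row (e : @L1_row R n) :
  forall i, int (fun x => (\row_i e i x : 'rV[R]_n) ord0 i).
Proof. by move=> i; under eq_fun do rewrite mxE; exact: L1_row_int. Qed.

Lemma integrand_energy_sublinear : sublinear integrand_energy.
Proof.
have ie e := integrand_integrable (@int_row e).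
split=> [e f|t e t0].
  rewrite -RintegralD//; apply: le_Rintegral => //;
    first exact: (integrableD mOm (ie e) (ie f)).
  move=> x Om_x; rewrite (_ : \row_i (e + f) i x = \row_i e i x + \row_i f i x).
    by have [phiD _ _] := phi_norm Om_x.
  by apply/rowP => i; rewrite !mxE.
rewrite -RintegralZl//; apply: le_Rintegral => //;
  first exact: (integrableZl mOm _ (ie e)).
move=> x Om_x; rewrite -phiZ// (_ : t *: \row_i e i x = \row_i (t *: e) i x)//.
by apply/rowP => i; rewrite !mxE.
Qed.

Lemma integrand_energy_le e :
  integrand_energy e <= alpha * \sum_(i < n) \int[mu]_(x in Om) `|e i x|.
Proof.
have ie i : int (e i) by exact: L1_row_int.
rewrite /Rintegral sum_fine; last first.
  by move=> i _; apply: (integrable_fin_num mOm); exact: (integrable_norm (ie i)).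
rewrite -integral_sum//; last by move=> i; exact: (integrable_norm (ie i)).
have := int_sum (@int_row e) => isum.
apply: (@le_trans _ _ (\int[mu]_(x in Om)
    (alpha * \sum_(i < n) `|(\row_i e i x : 'rV[R]_n) ord0 i|))).
  apply: le_Rintegral => //; first exact: integrand_integrable.
    exact: (integrableZl mOm _ isum).
  by move=> x; exact: phi_le.
rewrite RintegralZl// /Rintegral; rewrite le_eqVlt; apply/orP; left; apply/eqP.
congr (_ * fine _); apply: eq_integral => x _.
by rewrite sumEFin; congr EFin; apply: eq_bigr => i _; rewrite mxE.
Qed.

Let int_L2 w : L2_field Om w -> forall i, int (fun x => w x ord0 i).
Proof. by move=> L2w i; exact: L2_integrable. Qed.

Let int_dot w b : L2_field Om w -> L2_field Om b -> int (fun x => dot (w x) (b x)).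
Proof.
move=> L2w L2b.
rewrite (_ : EFin \o _ = fun x => (\sum_(i < n) (w x ord0 i * b x ord0 i)%:E)%E).
  by apply: integrable_sum => // i _; exact: L2_integrableM.
by apply/funext => x /=; rewrite sumEFin.
Qed.

Let L2_fieldD w b : L2_field Om w -> L2_field Om b ->
  L2_field Om (fun x => w x + b x).
Proof.
move=> L2w L2b i.
by have := L2_lin 1 (L2w i) (L2b i); under eq_fun do rewrite mul1r;
  under [X in _ -> L2 _ X]eq_fun do rewrite mxE.
Qed.

Lemma primal_energy_fin_num F H u Du : L2_field Om F -> L2 Om H ->
  H1_mean0 Om u Du -> primal_energy Om phi F H u Du \is a fin_num.
Proof.
move=> L2F L2H [[L2u L2Du _] _]; apply: (integrable_fin_num mOm).
have iHu : int (fun x => H x * u x) by exact: L2_integrableM.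
have ip := integrand_integrable (int_L2 (L2_fieldD L2Du L2F)).
exact: (integrableD mOm ip iHu).
Qed.

(* The integrand is nonnegative a.e. by feasibility of b; its vanishing is the
   optimality condition. *)
Lemma duality_gap F H u Du b : L2_field Om F -> L2 Om H ->
  H1_mean0 Om u Du -> dual_feasible Om phi H b ->
  (primal_energy Om phi F H u Du = dual_energy Om F b +
    \int[mu]_(x in Om) `|(phi x (Du x + F x) - dot (Du x + F x) (b x))%:E|)%E.
Proof.
move=> L2F L2H uDu [[L2b D0b] b1]; have [[L2u L2Du _] _] := uDu.
have L2v := L2_fieldD L2Du L2F.
have ip := integrand_integrable (int_L2 L2v).
have iv := int_dot L2v L2b.
have idb := int_dot L2Du L2b.
have iF := int_dot L2F L2b.
have iH : int (fun x => H x * u x) by exact: L2_integrableM.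
have ig : int (fun x => phi x (Du x + F x) - dot (Du x + F x) (b x)).
  exact: (integrableB mOm ip iv).
(* Feasibility of [b] gives the sign only almost everywhere. The absolute value in the statement
   makes the gap visibly nonnegative, as weak duality needs. *)
rewrite (_ : integral _ _ _ = \int[mu]_(x in Om)
    (phi x (Du x + F x) - dot (Du x + F x) (b x))%:E)%E; last first.
  apply: ae_eq_integral => //.
  - exact: measurableT_comp (measurable_int _ ig).
  - exact: measurable_int ig.
  apply: filterS b1 => x bx Om_x; rewrite /= ger0_norm// subr_ge0.
  have {}bx := bx Om_x; set v := Du x + F x.
  (* If [phi x v = 0] then [v = 0] and both sides vanish; otherwise [v] scaled to [phi]-length 1 is
     admissible in the supremum defining the dual norm. *)
  have [v0|v0] := eqVneq (phi x v) 0.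
    have [_ _ /(_ _ v0) ->] := phi_norm Om_x.
    by rewrite phi0// /dot big1// => i _; rewrite mxE mul0r.
  have vp : 0 < phi x v by rewrite lt_neqAle eq_sym v0 phi_ge0.
  have : ((dot (b x) ((phi x v)^-1 *: v))%:E <= 1)%E.
    apply: le_trans bx; apply: ereal_sup_ubound;
      exists ((phi x v)^-1 *: v) => //=.
    by rewrite phiZ ?invr_ge0 ?phi_ge0// mulVf.
  rewrite lee_fin (_ : dot (b x) _ = dot v (b x) / phi x v).
    by rewrite ler_pdivrMr// mul1r.
  by rewrite /dot mulr_suml; apply: eq_bigr => i _; rewrite mxE; ring.
rewrite /dual_energy -integralD//.
have := D0b _ _ uDu; rewrite /primal_energy => D0u.
(* The zero subtracted is the [D0] identity for [u], which cancels [H x * u x]. *)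
rewrite -[LHS]sube0 -D0u -integralB//; last 2 first.
  exact: (integrableD mOm ip iH).
  exact: (integrableD mOm idb iH).
apply: eq_integral => x _; rewrite -EFinB -EFinD; congr EFin.
have -> : dot (Du x + F x) (b x) = dot (Du x) (b x) + dot (F x) (b x).
  by rewrite /dot -big_split/=; apply: eq_bigr => i _; rewrite mxE mulrDl.
by ring.
Qed.

Lemma optimal_pair_ae F H u Du b : L2_field Om F -> L2 Om H ->
  H1_mean0 Om u Du -> dual_feasible Om phi H b ->
  primal_energy Om phi F H u Du = dual_energy Om F b ->
  {ae mu, forall x, Om x -> phi x (Du x + F x) = dot (Du x + F x) (b x)}.
Proof.
move=> L2F L2H uDu fb; rewrite (duality_gap L2F L2H uDu fb).
have [[[_ L2Du _] _] [[L2b _] _]] := (uDu, fb).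
have L2v := L2_fieldD L2Du L2F.
have iF : dual_energy Om F b \is a fin_num.
  by apply: (integrable_fin_num mOm); exact: int_dot.
set I := integral _ _ _ => gap.
have {gap} I0 : I = 0%E by rewrite -(addeK I iF) [(I + _)%E]addeC gap subee.
have mg : measurable_fun Om (fun x =>
    (phi x (Du x + F x) - dot (Du x + F x) (b x))%:E).
  have ip := integrand_integrable (int_L2 L2v).
  exact: measurable_int (integrableB mOm ip (int_dot L2v L2b)).
apply: filterS ((ae_eq_integral_abs mu mOm mg).1 I0) => x gx Om_x.
by have [/eqP] := gx Om_x; rewrite subr_eq0 => /eqP.
Qed.

Lemma L1_row_of_lin (a : R) w b : (forall i, int (fun x => w x ord0 i)) ->
  (forall i, int (fun x => b x ord0 i)) ->
  L1_row_of Om (fun x => a *: w x + b x) = a *: L1_row_of Om w + L1_row_of Om b.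
Proof.
move=> iw ib; apply/funext => i; apply/LfuneqP => x.
rewrite L1_row_ofE//; last first.
  by under eq_fun do rewrite !mxE;
    apply: (integrableD mOm (integrableZl mOm a (iw i)) (ib i)).
rewrite -[RHS]/(a * L1_row_of Om w i x + L1_row_of Om b i x) !L1_row_ofE// !patchE.
by case: ifP => _; rewrite ?mxE// mulr0 addr0.
Qed.

(** Both sides are [alpha]-Lipschitz in [v] for the l^1 distance, so rational vectors suffice. *)
Let phi_ge_dot x (N : 'rV[R]_n) : Om x -> (forall i, `|N ord0 i| <= alpha) ->
  (forall q : 'rV[rat]_n, dot (map_mx ratr q) N <= phi x (map_mx ratr q)) ->
  forall v, dot v N <= phi x v.
Proof.
move=> Om_x Na Nq v; apply/ler_addgt0Pr => e e0.
(* Replacing [v] by [w] costs at most [alpha * n * d] on each side; [n.+1] keeps the denominator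
   positive. *)
pose d := e / (2 * alpha * n.+1%:R).
have p0 : 0 < 2 * alpha * n.+1%:R by rewrite !mulr_gt0.
have [|q vq] := @row_rat_approx _ _ v d; first by rewrite divr_gt0.
pose w : 'rV[R]_n := map_mx ratr q.
have S : \sum_(i < n) `|(v - w) ord0 i| <= n%:R * d.
  rewrite mulr_natl -[X in _ *+ X](card_ord n) -sumr_const.
  by apply: ler_sum => i _; rewrite !mxE ltW.
have -> : dot v N = dot w N + dot (v - w) N.
  by rewrite /dot -big_split/=; apply: eq_bigr => i _;
    rewrite !mxE -mulrDl subrKC.
have h1 : dot (v - w) N <= alpha * \sum_(i < n) `|(v - w) ord0 i|.
  rewrite mulr_sumr; apply: ler_sum => i _; apply: (le_trans (ler_norm _)).
  by rewrite normrM mulrC ler_wpM2r.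
have h2 : phi x w <= phi x v + phi x (w - v).
  by have [phiD _ _] := phi_norm Om_x; rewrite -{1}(subrKC v w) phiD.
have h3 : phi x (w - v) <= alpha * \sum_(i < n) `|(v - w) ord0 i|.
  by rewrite -opprB; have [_ phiN _] := phi_norm Om_x;
    rewrite -scaleN1r phiN normrN1 mul1r phi_le.
have h4 : 2 * alpha * (n%:R * d) <= e.
  rewrite /d; apply: (@le_trans _ _ (2 * alpha * (n.+1%:R * (e / (2 * alpha * n.+1%:R))))).
    apply: ler_wpM2l; first by rewrite mulr_ge0// ltW.
    by apply: ler_wpM2r; [rewrite ltW// divr_gt0|rewrite ler_nat].
  by rewrite (mulrA (2 * alpha)) (mulrCA (2 * alpha * _)) divff ?mulr1// gt_eqF.
have h5 : alpha * \sum_(i < n) `|(v - w) ord0 i| <= alpha * (n%:R * d).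
  by rewrite ler_wpM2l// ltW.
have := Nq q; rewrite -/w; lra.
Qed.

(** Strong half of the duality: applied with [m] equal to the finite infimum, it yields an optimal
    dual field. *)
Lemma dual_field_exists F H (m : R) : L2_field Om F -> L2 Om H ->
  (forall u Du, H1_mean0 Om u Du ->
    (m%:E <= primal_energy Om phi F H u Du)%E) ->
  exists2 N, dual_feasible Om phi H N & (m%:E <= dual_energy Om F N)%E.
Proof.
move=> L2F L2H mP.
have iHu u Du : H1_mean0 Om u Du -> int (fun x => H x * u x).
  by move=> [[L2u _ _] _]; exact: L2_integrableM.
have iDu u Du : H1_mean0 Om u Du -> forall i, int (fun x => Du x ord0 i).
  by move=> [[_ L2Du _] _]; exact: int_L2.
pose K := [set a : @L1_row R n * R | exists u Du, H1_mean0 Om u Du /\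
  a = (L1_row_of Om Du, \int[mu]_(x in Om) (H x * u x))].
have Klin t a c : K a -> K c -> K (t *: a.1 + c.1, t * a.2 + c.2).
  move=> [u [Du [uDu ->]]] [v [Dv [vDv ->]]].
  exists (fun x => t * u x + v x), (fun x => t *: Du x + Dv x).
  split; first exact: H1_mean0_lin.
  rewrite L1_row_of_lin; [|exact: iDu uDu|exact: iDu vDv].
  congr pair; rewrite /= -RintegralZl// -?RintegralD//.
  - by apply: eq_Rintegral => x _; ring.
  - exact: (integrableZl mOm t (iHu _ _ uDu)).
  - exact: iHu vDv.
  - exact: iHu uDu.
have K0 : K (0, 0).
  exists (fun=> 0), (fun=> 0); split; first exact: H1_mean00.
  congr pair; last first.
    by under eq_Rintegral do rewrite mulr0; rewrite Rintegral_cst// mul0r.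
  apply/funext => i; apply/LfuneqP => x; rewrite L1_row_ofE//.
    by rewrite patchE mxE; case: ifP.
  by under eq_fun do rewrite mxE; exact: integrable0.
have [|||l [ll lp lK lF]] := @sublinear_duality R (@L1_row R n) _ K
    (L1_row_of Om F) m integrand_energy_sublinear.
- split=> // [a b Ka Kb|t a _ Ka].
    by have := Klin 1 a b Ka Kb; rewrite scale1r mul1r.
  by have := Klin t a (0, 0) Ka K0; rewrite /= !addr0.
- move=> a Ka; have := Klin (-1) a (0, 0) Ka K0.
  by rewrite /= !addr0 scaleN1r mulN1r.
- move=> _ [u [Du [uDu ->]]] /=; have [[L2u L2Du _] _] := uDu.
  have := mP u Du uDu; rewrite /primal_energy.
  have ip := integrand_integrable (int_L2 (L2_fieldD L2Du L2F)).
  rewrite -[X in (_ <= X)%E -> _]fineK; last exact: primal_energy_fin_num.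
  rewrite lee_fin => /le_trans; apply.
  rewrite -[X in X <= _]/(Rintegral mu Om (fun x => phi x (Du x + F x) + H x * u x)).
  rewrite RintegralD//; last exact: iHu uDu.
  rewrite lerD2r le_eqVlt; apply/orP; left; apply/eqP.
  apply: eq_Rintegral => x xOm; congr phi; apply/rowP => i; rewrite !mxE.
  rewrite -[RHS]/(L1_row_of Om F i x + L1_row_of Om Du i x).
  rewrite !L1_row_ofE ?patchE ?xOm 1?addrC//;
    [exact: int_L2 L2Du i|exact: int_L2 L2F i].
(* The same [alpha] bounds every component of [N], which serves for [L2N] and for the density
   argument. *)
have [N [mN Na lN]] := bounded_row_functional oOm bOm ll (ltW alpha_gt0)
  (fun e => le_trans (lp e) (integrand_energy_le e)).
have L2N : L2_field Om N.
  by move=> i; apply: (@bounded_L2 _ _ _ oOm bOm _ alpha) => //;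
    exact: measurable_funTS.
have lw w : (forall i, int (fun x => w x ord0 i)) ->
    \int[mu]_(x in Om) dot (w x) (N x) <= \int[mu]_(x in Om) phi x (w x).
  move=> iw; rewrite -lN//; apply: (le_trans (lp _)).
  rewrite le_eqVlt; apply/orP; left; apply/eqP.
  apply: eq_Rintegral => x xOm; congr phi; apply/rowP => i; rewrite !mxE.
  by rewrite L1_row_ofE// patchE xOm.
exists N; last first.
  rewrite /dual_energy -[leRHS]fineK;
    first by rewrite lee_fin (le_trans lF)// lN//; exact: int_L2.
  by apply: (integrable_fin_num mOm); exact: int_dot.
split; first split=> //.
  move=> u Du uDu; have [[_ L2Du _] _] := uDu.
  rewrite -[LHS]fineK; last first.
    by apply: (integrable_fin_num mOm);
      exact: (integrableD mOm (int_dot L2Du L2N) (iHu _ _ uDu)).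
  rewrite -[fine _]/(Rintegral mu Om (fun x => dot (Du x) (N x) + H x * u x)).
  rewrite RintegralD//; [|exact: int_dot|exact: iHu uDu].
  have /lK/= : K (L1_row_of Om Du, \int[mu]_(x in Om) (H x * u x)) by exists u, Du.
  by rewrite lN; [move=> ->|exact: iDu uDu].
have aeq (q : 'rV[rat]_n) : {ae mu, forall x, Om x ->
    dot (map_mx ratr q) (N x) <= phi x (map_mx ratr q)}.
  set v : 'rV[R]_n := map_mx ratr q.
  have L2v : L2_field Om (cst v).
    by move=> i; apply: (@bounded_L2 _ _ _ oOm bOm _ `|v ord0 i|) => //;
      exact: measurable_cst.
  apply: ae_le_of_integral => //.
  - exact: int_dot L2v L2N.
  - exact: integrand_integrable (int_L2 L2v).
  (* The test field is [\1_A x *: v]: both integrands vanish off [A], which leaves the comparison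
     over [A]. *)
  move=> A mA AOm.
  have := lw (fun x => \1_A x *: v).
  rewrite -(setIidr AOm) 2!Rintegral_mkcondr (setIidr AOm) => lwA.
  have {}lwA := lwA _; rewrite (@eq_Rintegral _ _ _ mu _ (fun x => dot (\1_A x *: v) (N x))).
    rewrite [leRHS](@eq_Rintegral _ _ _ mu _ (fun x => phi x (\1_A x *: v))).
      apply: lwA => i.
      have i1 : int (\1_A : 'rV[R]_n -> R).
        apply: measurable_bounded_integrable => //.
        - exact: lebesgue_row_bounded_lty.
        - exists 1; split=> // y y1 x _ /=; rewrite (le_trans _ (ltW y1))//.
          by rewrite indicE; case: (_ \in _); rewrite ?normr1 ?normr0.
      rewrite (_ : (fun x => _) = fun x => v ord0 i * \1_A x).
        exact: (integrableZl mOm (v ord0 i) i1).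
      by apply/funext => x; rewrite mxE mulrC.
    move=> x /set_mem Om_x; rewrite patchE indicE; case: ifP => _;
      first by rewrite scale1r.
    by rewrite scale0r phi0.
  move=> x _; rewrite patchE indicE; case: ifP => _; first by rewrite scale1r.
  by rewrite scale0r /dot big1// => i _; rewrite mxE mul0r.
(* Enumerating the rational vectors through [unpickle] gives one null set for all of them; an index
   that codes no vector carries the trivial [true]. *)
have ae_all : {ae mu, forall x, forall k, Om x ->
    if unpickle k is Some q then
      dot (map_mx ratr (q : 'rV[rat]_n)) (N x) <= phi x (map_mx ratr q) else true}.
  apply: ae_foralln => k; case: (unpickle k) => [q|]; first exact: aeq.
  by apply/aeW.
apply: filterS ae_all => x Nx Om_x; apply: ge_ereal_sup => _ [v /= v1 <-].
rewrite lee_fin; apply: le_trans v1.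
rewrite (_ : dot (N x) v = dot v (N x)); last by apply: eq_bigr => i _;
  rewrite mulrC.
apply: phi_ge_dot => // q.
by have := Nx (pickle q) Om_x; rewrite pickleK.
Qed.

End convex_integrand.

(** The field is asserted for an infimum other than [-oo]: a feasible field has finite dual energy,
    which weak duality puts below the infimum, so at [-oo] the dual has no feasible field and both
    values are [-oo]. *)
Theorem theorem2p2 (R : realType) (n : nat) (Om : set 'rV[R]_n)
  (F : 'rV[R]_n -> 'rV[R]_n) (H : 'rV[R]_n -> R)
  (phi : 'rV[R]_n -> 'rV[R]_n -> R) (alpha : R)
  (n_gt0 : (0 < n)%N)
  (Om_domain : bounded_domain Om)
  (Om_lipschitz : lipschitz_boundary Om)
  (F_L2 : L2_field Om F)
  (H_L2 : L2 Om H)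
  (phi_measurable : forall xi, measurable_fun Om (phi ^~ xi))
  (phi_convex : forall x, Om x ->
     convex_function [set: convex_lmodType 'rV[R]_n] (phi x))
  (phi_continuous : forall x, Om x -> continuous (phi x))
  (phi_homogeneous : forall x, Om x ->
     forall (t : R) xi, 0 <= t -> phi x (t *: xi) = t * phi x xi)
  (alpha_gt0 : 0 < alpha)
  (phi_bounds : forall x, Om x ->
     forall xi, 0 <= phi x xi <= alpha * enorm xi)
  (phi_norm : forall x, Om x -> is_norm (phi x)) :
  primal_inf Om phi F H = dual_sup Om phi F H /\
  (primal_inf Om phi F H != -oo%E ->
   exists N : 'rV[R]_n -> 'rV[R]_n,
     [/\ dual_feasible Om phi H N,
         primal_inf Om phi F H = dual_energy Om F N &
         forall (u : 'rV[R]_n -> R) (Du : 'rV[R]_n -> 'rV[R]_n),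
           primal_minimizer Om phi F H u Du ->
           {ae variation_measure Om (fun x => Du x + F x),
             forall x, Om x ->
             phi x ((enorm (Du x + F x))^-1 *: (Du x + F x)) =
             dot (N x) ((enorm (Du x + F x))^-1 *: (Du x + F x))}]).
Proof.
have [oOm _ _ bOm] := Om_domain.
have mOm : measurable Om by exact: row_open_measurable.
have gap u Du b := duality_gap oOm bOm phi_measurable phi_continuous alpha_gt0
  phi_bounds phi_norm (u := u) (Du := Du) (b := b) F_L2 H_L2.
have weak b : dual_feasible Om phi H b ->
    (dual_energy Om F b <= primal_inf Om phi F H)%E.
  move=> fb; apply: le_ereal_inf_tmp => _ [[u Du] /= uDu <-].
  by rewrite (gap _ _ _ uDu fb) leeDl// integral_ge0.
have supinf : (dual_sup Om phi F H <= primal_inf Om phi F H)%E.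
  by apply: ge_ereal_sup => _ [b fb <-]; exact: weak.
have [infNy|infNy] := eqVneq (primal_inf Om phi F H) -oo%E.
  by split=> //; move: supinf; rewrite infNy leeNy_eq => /eqP.
(* The competitor [u = 0] has finite energy. *)
have inf_fin : primal_inf Om phi F H \is a fin_num.
  have /= H00 := @H1_mean00 _ _ _ oOm bOm.
  pose J0 := primal_energy Om phi F H (fun=> 0) (fun=> 0).
  rewrite fin_numE infNy -ltey (@le_lt_trans _ _ J0)//.
    by apply: ge_ereal_inf; exists J0 => //; exists (fun=> 0, fun=> 0).
  rewrite ltey_eq (primal_energy_fin_num oOm bOm phi_measurable phi_continuous
    alpha_gt0 phi_bounds F_L2 H_L2)//.
have [|N fN] := dual_field_exists oOm bOm phi_measurable phi_continuous
  alpha_gt0 phi_bounds phi_norm (m := fine (primal_inf Om phi F H)) F_L2 H_L2.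
  by move=> u Du uDu; rewrite fineK//; apply: ge_ereal_inf;
    exists (primal_energy Om phi F H u Du) => //; exists (u, Du).
rewrite fineK// => infN.
have infE : primal_inf Om phi F H = dual_energy Om F N.
  by apply/eqP; rewrite eq_le infN weak.
split.
  by apply/eqP; rewrite eq_le supinf andbT infE; apply: ereal_sup_ubound;
    exists N.
move=> _; exists N; split=> // u Du [uDu umin].
have [[[_ L2Du _] _] _] := (uDu, fN).
have := optimal_pair_ae oOm bOm phi_measurable phi_continuous alpha_gt0
  phi_bounds phi_norm F_L2 H_L2 uDu fN (etrans umin infE).
(* The measure [|Du + F| dx] vanishes on Lebesgue null sets, so the same exceptional set serves. *)
move=> [A [mA A0 subA]]; exists A; split=> //.
  have mAOm : measurable (A `&` Om) by exact: measurableI.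
  apply: null_set_integral => //.
    apply/measurable_EFinP; apply: (measurable_funS mOm (@subIsetr _ A Om)).
    apply: measurable_enorm => i; under eq_fun do rewrite mxE.
    by apply: measurable_funD; exact: (L2_measurable oOm).
  apply/eqP; rewrite -measure_le0 -A0; apply: le_measure; rewrite ?inE//;
    exact: subIsetl.
move=> x /= opt; apply: subA => /= eqx; apply: opt => Om_x.
(* Both sides scale by the nonnegative factor [(enorm v)^-1] with [v = Du x + F x]; where [v = 0]
   this inverse is 0 and the equality is trivial. *)
rewrite phi_homogeneous// ?invr_ge0 ?sqrtr_ge0// eqx//.
by rewrite /dot mulr_sumr; apply: eq_bigr => i _; rewrite !mxE; ring.
Qed.
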